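(* Let $\Upsilon$ and $\widehat\Upsilon$ be $\mathbf t$-modules over $K$ having composition series $$0=\Upsilon_0\subset\Upsilon_1\subset\cdots\subset\Upsilon_{n-1}\subset\Upsilon_n=\Upsilon,\qquad 0=\widehat\Upsilon_0\subset\widehat\Upsilon_1\subset\cdots\subset\widehat\Upsilon_{m-1}\subset\widehat\Upsilon_m=\widehat\Upsilon$$ (each inclusion being an inclusion of a $\tau$-submodule) such that for $i=1,\dots,n$ and $j=1,\dots,m$: (i) the quotients $\sigma_i=\Upsilon_i/\Upsilon_{i-1}$ and $\widehat\sigma_j=\widehat\Upsilon_j/\widehat\Upsilon_{j-1}$ are $\tau$-simple $\mathbf t$-modules; (ii) $\mathrm{Hom}_\tau(\sigma_i,\widehat\sigma_j)=0$; (iii) for every pair $(i,j)$ the space $\mathrm{Ext}^1_\tau(\sigma_i,\widehat\sigma_j)$ has a $\mathbf t$-module structure coming from $\mathbf t$-reduction. Then the space $\mathrm{Ext}^1_\tau(\Upsilon,\widehat\Upsilon)$ has a $\mathbf t$-module structure coming from $\mathbf t$-reduction.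
   Context: Basic notation. Let $q$ be a power of a prime, $K$ a field with an $\mathbb F_q$-algebra homomorphism $\iota:\mathbb F_q[t]\to K$, and $\theta:=\iota(t)$. $K\{\tau\}$ is the twisted polynomial ring with $\tau u=u^q\tau$ for $u\in K$. A $\mathbf t$-module over $K$ of dimension $d$ is an $\mathbb F_q$-algebra homomorphism $\Phi:\mathbb F_q[t]\to \mathrm{Mat}_d(K\{\tau\})$ such that $\Phi_t:=\Phi(t)=(\theta I+N_\Phi)\tau^0+\sum_{i=1}^nA_i\tau^i$ with $N_\Phi,A_i\in\mathrm{Mat}_d(K)$ and $N_\Phi$ nilpotent; there is also the zero $\mathbf t$-module. For $\mathbf t$-modules $\Phi,\Psi$ of dimensions $d,e$, a morphism $\Psi\to\Phi$ is $f\in\mathrm{Mat}_{d\times e}(K\{\tau\})$ with $f\Psi_t=\Phi_tf$; the set of morphisms is $\mathrm{Hom}_\tau(\Psi,\Phi)$. $E_{i\times j}$ is the $e\times d$ matrix with $1$ in position $(i,j)$ and $0$ elsewhere. Extensions. $\mathrm{Ext}^1_\tau(\Phi,\Psi)$ is the Baer group of extensions $0\to\Psi\to\Gamma\to\Phi\to0$ of $\mathbf t$-modules. A biderivation is an $\mathbb F_q$-linear map $\delta:\mathbb F_q[t]\to\mathrm{Mat}_{e\times d}(K\{\tau\})$ with $\delta(ab)=\Psi(a)\delta(b)+\delta(a)\Phi(b)$; it is determined by $\delta_t:=\delta(t)$, which may be arbitrary, so $\mathrm{Der}(\Phi,\Psi)\cong\mathrm{Mat}_{e\times d}(K\{\tau\})$.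 Every short exact sequence $0\to\Psi\to\Gamma\to\Phi\to0$ is, up to isomorphism, given by a biderivation: $\Gamma_t=\begin{bmatrix}\Phi_t&0\\ \delta_t&\Psi_t\end{bmatrix}$, with $\Psi\to\Gamma$ the inclusion on the second block of coordinates and $\Gamma\to\Phi$ the projection on the first. For $U\in\mathrm{Mat}_{e\times d}(K\{\tau\})$ the inner biderivation $\delta^{(U)}$ is given by $\delta^{(U)}_t=U\Phi_t-\Psi_tU$, and $\mathrm{Der}_{in}(\Phi,\Psi)$ is the set of these. One has $\mathrm{Ext}^1_\tau(\Phi,\Psi)\cong\mathrm{Der}(\Phi,\Psi)/\mathrm{Der}_{in}(\Phi,\Psi)$ as $\mathbb F_q[t]$-modules, with $t*\delta=\Psi_t\cdot\delta_t$. Submodules and simplicity. A $\mathbf t$-module $\Psi$ is a $\tau$-submodule of $\Upsilon$ if there is a short exact sequence of $\mathbf t$-modules $0\to\Psi\to\Upsilon\to\Upsilon/\Psi\to0$ (in particular the quotient is a $\mathbf t$-module). A $\mathbf t$-module is $\tau$-simple if it has no non-trivial $\tau$-submodules, i.e. it is not the middle term of a short exact sequence of $\mathbf t$-modules with nonzero terms. $\mathbf t$-reduction. For a matrix $N=[n_{i,j}]$ of non-negative integers let $\mathrm{Mat}_{e\times d}(K\{\tau\})_{<N}$ be the set of $[w_{i,j}]\in \mathrm{Mat}_{e\times d}(K\{\tau\})$ with $\deg_\tau w_{i,j}<n_{i,j}$ for all $i,j$. A basis $(U_{i\times j})$ of $\mathrm{Mat}_{e\times d}(K)$ is said to satisfy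 conditions A–D (for $\Phi,\Psi$) if: (A) the inner biderivations $\delta^{(c\tau^kU_{i\times j})}$ ($c\in K$, $k\ge0$) form a basis of $\mathrm{Der}_{in}(\Phi,\Psi)$, in the sense that every inner biderivation is uniquely a finite sum of $\delta^{(c_{i,j,k}\tau^kU_{i\times j})}$, one for each triple $(i,j,k)$, with $c_{i,j,k}\in K$; (B) for $c\neq0$ the $(i,j)$ entry of $\delta_t^{(c\tau^kU_{i\times j})}$ is a twisted polynomial whose coefficient at the biggest power of $\tau$ is $c$; (C) with $N=[n_{i,j}]$, $n_{i,j}$ the $\tau$-degree of the $(i,j)$ entry of $\delta_t^{(c\tau^0U_{i\times j})}$ ($c\ne0$), every biderivation $\delta$ can be reduced, by subtracting finitely many $\delta^{(c_l\tau^{k_l}U_{i_l\times j_l})}$, to an element of $\mathrm{Mat}_{e\times d}(K\{\tau\})_{<N}$; (D) different elements of $\mathrm{Mat}_{e\times d}(K\{\tau\})_{<N}$ represent different elements of $\mathrm{Ext}^1_\tau(\Phi,\Psi)$. Then $\mathrm{Ext}^1_\tau(\Phi,\Psi)\cong\mathrm{Mat}_{e\times d}(K\{\tau\})_{<N}$ as $\mathbb F_q$-spaces. Transfer multiplication by $t$: for each generator $E_{i\times j}c\tau^k$ ($0\le k<n_{i,j}$, $c\in K$) reduce $\Psi_t E_{i\times j}c\tau^k$ to an element of $\mathrm{Mat}_{e\times d}(K\{\tau\})_{<N}$ and write the coordinates in the system $E_{a\times b}\tau^l$ as values at $c$ of twisted polynomials in $K\{\tau\}$ (with $\tau^m$ evaluated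 at $c$ being $c^{q^m}$). The resulting vectors of twisted polynomials are the columns of a square matrix $\Pi_t$ of size $\sum n_{i,j}$. One says that $\mathrm{Ext}^1_\tau(\Phi,\Psi)$ has a $\mathbf t$-module structure coming from $\mathbf t$-reduction if such a basis $(U_{i\times j})$ exists and the procedure yields a $\mathbf t$-module $t\mapsto\Pi_t$.
   Formalization: t-reduction is required, in (iii) and in the conclusion, to be uniform: the subtracted coefficients are twisted polynomials in c. The conclusion holds after isomorphic choices of Υ, Υ̂, and in the given coordinates if the series are in block form. The literal claim fails otherwise. *)

(* Defs.v *)
From HB Require Import structures.
From mathcomp Require Import all_boot all_order all_algebra all_fingroup all_solvable all_field.

Set Implicit Arguments.
Unset Strict Implicit.
Unset Printing Implicit Defensive.

Import GRing.Theory.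
Local Open Scope ring_scope.

(* The twisted polynomial ring K{tau}: the polynomial \sum_i a_i 'X^i stands
   for \sum_i a_i tau^i, scalars being written on the left of tau.  This is a
   separate type since its product, which depends on F only through q = #|F|,
   is not that of {poly K}. *)
Record tpoly (F : finFieldType) (K : fieldType)
    (iota : {rmorphism {poly F} -> K}) := TPoly { tpoly_val : {poly K} }.

Section TwistedPolynomials.

(* A ring morphism iota : F[t] -> K makes the field K an algebra over its
   finite field of constants F; here q = #|F|. *)
Variables (F : finFieldType) (K : fieldType) (iota : {rmorphism {poly F} -> K}).

Local Notation q := #|F|%N.

Lemma pchar_nat_card_expn k : [pchar K].-nat (q ^ k)%N.
Proof.
have Fq : [pchar F].-nat q.
  apply/pnatP; first by apply/card_gt0P; exists 0.
  move=> r r_pr; rewrite -cardsT => /(Cauchy r_pr)[x _ ox].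
  have x0 : x != 0 by apply: contraL (prime_gt1 r_pr) => /eqP x0; rewrite -ox x0 order1.
  have /eqP: x *+ r = 0 by rewrite -FinRing.zmodXgE -ox expg_order.
  by rewrite -mulr_natr mulf_eq0 (negPf x0) /= inE r_pr => ->.
rewrite pnatX; apply/orP; left; apply: sub_in_pnat Fq => r _ rF.
exact: (rmorph_pchar (iota \o polyC)).
Qed.

Lemma exprqD (x y : K) k :
  (x + y) ^+ (q ^ k) = x ^+ (q ^ k) + y ^+ (q ^ k).
Proof. exact/exprDn_pchar/pchar_nat_card_expn. Qed.

Lemma expr0q k : 0 ^+ (q ^ k) = 0 :> K.
Proof.
have q_gt0 : (0 < q)%N by apply/card_gt0P; exists 0.
by rewrite expr0n expn_eq0 -leqn0 leqNgt q_gt0.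
Qed.

Lemma exprq_sum I (r : seq I) (P : pred I) (G : I -> K) k :
  (\sum_(i <- r | P i) G i) ^+ (q ^ k) = \sum_(i <- r | P i) G i ^+ (q ^ k).
Proof.
by apply: (big_morph (fun x => x ^+ _)) => [x y|]; rewrite (exprqD, expr0q).
Qed.

Local Notation tpoly := (tpoly iota).
Local Notation TPoly := (TPoly iota).

HB.instance Definition _ := [isNew for @tpoly_val F K iota].
HB.instance Definition _ := [Choice of tpoly by <:].

Implicit Types f g h : tpoly.

Definition tcoef f k : K := (tpoly_val f)`_k.

Lemma tpolyP f g : (forall k, tcoef f k = tcoef g k) -> f = g.
Proof. by move=> eq_fg; apply/val_inj/polyP. Qed.

Definition tadd f g := TPoly (tpoly_val f + tpoly_val g).
Definition topp f := TPoly (- tpoly_val f).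

Fact taddA : associative tadd.
Proof. by move=> f g h; apply: val_inj; rewrite /= addrA. Qed.
Fact taddC : commutative tadd.
Proof. by move=> f g; apply: val_inj; rewrite /= addrC. Qed.
Fact tadd0 : left_id (TPoly 0) tadd.
Proof. by move=> f; apply: val_inj; rewrite /= add0r. Qed.
Fact taddN : left_inverse (TPoly 0) topp tadd.
Proof. by move=> f; apply: val_inj; rewrite /= addNr. Qed.

HB.instance Definition _ := GRing.isZmodule.Build tpoly taddA taddC tadd0 taddN.

(* (a tau^i) (b tau^j) = a b^(q^i) tau^(i + j) *)
Definition tmul f g :=
  TPoly (\poly_(k < size (tpoly_val f) + size (tpoly_val g))
           \sum_(i < k.+1) tcoef f i * tcoef g (k - i) ^+ (q ^ i)).

Lemma tcoefD f g k : tcoef (f + g) k = tcoef f k + tcoef g k.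
Proof. exact: coefD. Qed.

Lemma tcoef_mul f g k :
  tcoef (tmul f g) k = \sum_(i < k.+1) tcoef f i * tcoef g (k - i) ^+ (q ^ i).
Proof.
rewrite {1}/tcoef coef_poly; case: ltnP => // le_k.
rewrite big1 // => i _; rewrite /tcoef.
have [le_i | lt_i] := leqP (size (tpoly_val f)) i.
  by rewrite nth_default // mul0r.
have -> : (tpoly_val g)`_(k - i) = 0.
  apply: nth_default; rewrite leq_subRL; last by rewrite -ltnS.
  by apply: leq_trans le_k; rewrite leq_add2r ltnW.
by rewrite expr0q mulr0.
Qed.

Lemma tcoef_mul_rev f g k :
  tcoef (tmul f g) k =
    \sum_(i < k.+1) tcoef f (k - i) * tcoef g i ^+ (q ^ (k - i)).
Proof.
rewrite tcoef_mul (reindex_inj rev_ord_inj) /=.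
by apply: eq_bigr => i _; rewrite (sub_ordK i).
Qed.

Fact tmulA : associative tmul.
Proof.
move=> f g h; apply: tpolyP => i; rewrite tcoef_mul tcoef_mul_rev.
pose coef3 j k := tcoef f j *
  (tcoef g (i - j - k) ^+ (q ^ j) * tcoef h k ^+ (q ^ (i - k))).
transitivity (\sum_(j < i.+1) \sum_(k < i.+1 | (k <= i - j)%N) coef3 j k).
  apply: eq_bigr => /= j _; rewrite tcoef_mul_rev exprq_sum big_distrr /=.
  rewrite (big_ord_narrow_leq (leq_subr _ _)); apply: eq_bigr => k _.
  rewrite /coef3 exprMn -exprM -expnD /=; suff -> : (i - j - k + j = i - k)%N by [].
  have /= := ltn_ord k; have /= := ltn_ord j; rewrite !ltnS => lej lek.
  by rewrite subnAC subnK // leq_subRL ?(leq_trans lek) ?leq_subr // addnC -leq_subRL.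
rewrite (exchange_big_dep predT) //=; apply: eq_bigr => k _.
transitivity (\sum_(j < i.+1 | (j <= i - k)%N) coef3 j k).
  apply: eq_bigl => j; rewrite -ltnS -(ltnS j) -!subSn ?leq_ord //.
  by rewrite -subn_gt0 -(subn_gt0 j) -!subnDA addnC.
rewrite (big_ord_narrow_leq (leq_subr _ _)) tcoef_mul big_distrl /=.
by apply: eq_bigr => j _; rewrite /coef3 -!subnDA addnC mulrA.
Qed.

Fact tmul1 : left_id (TPoly 1) tmul.
Proof.
move=> f; apply: tpolyP => k; rewrite tcoef_mul big_ord_recl big1 => [|i _].
  by rewrite /tcoef coef1 mul1r subn0 addr0.
by rewrite /tcoef coef1 mul0r.
Qed.

Fact tmulr1 : right_id (TPoly 1) tmul.
Proof.
move=> f; apply: tpolyP => k; rewrite tcoef_mul_rev big_ord_recl big1 => [|i _].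
  by rewrite /tcoef coef1 expr1n mulr1 subn0 addr0.
by rewrite /tcoef coef1 expr0q mulr0.
Qed.

Fact tmulDl : left_distributive tmul +%R.
Proof.
move=> f g h; apply: tpolyP => k; rewrite tcoefD !tcoef_mul -big_split /=.
by apply: eq_bigr => i _; rewrite tcoefD mulrDl.
Qed.

Fact tmulDr : right_distributive tmul +%R.
Proof.
move=> f g h; apply: tpolyP => k; rewrite tcoefD !tcoef_mul -big_split /=.
by apply: eq_bigr => i _; rewrite tcoefD exprqD mulrDr.
Qed.

Fact tone_neq0 : TPoly 1 != 0.
Proof. by apply/eqP => /(congr1 (@tpoly_val _ _ _)) /= /eqP; rewrite oner_eq0. Qed.

HB.instance Definition _ := GRing.Zmodule_isNzRing.Build tpoly
  tmulA tmul1 tmulr1 tmulDl tmulDr tone_neq0.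

(* the monomial c tau^k *)
Definition tmon (c : K) k : tpoly := TPoly (c *: 'X^k).

Definition tconst (c : K) : tpoly := tmon c 0.

(* 1 + the degree in tau, and 0 for the zero twisted polynomial *)
Definition tsize f : nat := size (tpoly_val f).

Definition tlead f : K := lead_coef (tpoly_val f).

Definition teval f (c : K) : K := \sum_(i < tsize f) tcoef f i * c ^+ (q ^ i).

End TwistedPolynomials.

Lemma tau_tconst (F : finFieldType) (K : fieldType)
    (iota : {rmorphism {poly F} -> K}) (u : K) :
  tmon iota 1 1 * tconst iota u = tconst iota (u ^+ #|F|) * tmon iota 1 1.
Proof.
apply: tpolyP => k; rewrite !tcoef_mul.
case: k => [|[|k]].
- by rewrite !big_ord1 /tcoef /= !coefZ !coefXn /= !(mulr0, mul0r).
- by rewrite !big_ord_recl !big_ord0 /tcoef /= !coefZ !coefXn /= expn0 expn1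
       !(mulr0, mul0r, mulr1, mul1r, addr0, add0r, expr1).
rewrite !big1 // => i _; rewrite /tcoef /= !coefZ !coefXn.
  by case: (val i) => [|[|j]]; rewrite ?(mulr0, mul0r).
by case: (val i) => [|[|j]]; rewrite /= ?(mulr0, mul0r, expr0q).
Qed.

Section TModules.

Variables (F : finFieldType) (K : fieldType) (iota : {rmorphism {poly F} -> K}).

Local Notation Kt := (tpoly iota).
Local Notation tmon := (tmon iota).
Local Notation tconst := (tconst iota).

(* Dimension 0 is allowed and gives the zero t-module. *)
Record tmodule := TModule {
  tdim : nat;
  tact :> {rmorphism {poly F} -> 'M[Kt]_tdim};
  tact_scalar : forall c : F, tact c%:P = (tconst (iota c%:P))%:M;
  tact_tangent : exists2 N : 'M[K]_tdim, exists k, N ^+ k = 0 &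
    map_mx (fun f => tcoef f 0) (tact 'X) = (iota 'X)%:M + N }.

Implicit Types (Phi Psi Gamma : tmodule).

Definition is_hom Psi Phi (f : 'M[Kt]_(tdim Phi, tdim Psi)) : Prop :=
  f *m Psi 'X = Phi 'X *m f.

Definition is_iso Psi Phi (f : 'M[Kt]_(tdim Phi, tdim Psi)) : Prop :=
  is_hom f /\
  exists g : 'M[Kt]_(tdim Psi, tdim Phi), f *m g = 1%:M /\ g *m f = 1%:M.

Definition isomorphic Psi Phi : Prop :=
  exists f : 'M[Kt]_(tdim Phi, tdim Psi), is_iso f.

Definition biderivation Phi Psi
    (delta : {poly F} -> 'M[Kt]_(tdim Psi, tdim Phi)) : Prop :=
  (forall (c : F) a b,
     delta (c *: a + b) = tconst (iota c%:P) *: delta a + delta b) /\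
  (forall a b, delta (a * b) = Psi a *m delta b + delta a *m Phi b).

(* the inner biderivation of U *)
Definition inner Phi Psi (U : 'M[Kt]_(tdim Psi, tdim Phi)) (a : {poly F}) :=
  U *m Phi a - Psi a *m U.

(* The sequence Psi -i-> Gamma -p-> Phi in which Gamma is the block matrix
   t-module of a biderivation, i is the inclusion of the second block of
   coordinates and p the projection onto the first one. *)
Definition block_exact Psi Gamma Phi (i : 'M[Kt]_(tdim Gamma, tdim Psi))
    (p : 'M[Kt]_(tdim Phi, tdim Gamma)) : Prop :=
  exists (delta : {poly F} -> 'M[Kt]_(tdim Psi, tdim Phi))
         (e : tdim Gamma = (tdim Phi + tdim Psi)%N),
  [/\ biderivation delta,
      forall a, castmx (e, e) (Gamma a) = block_mx (Phi a) 0 (delta a) (Psi a),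
      castmx (e, erefl) i = col_mx 0 1%:M &
      castmx (erefl, e) p = row_mx 1%:M 0].

(* A short exact sequence of t-modules is one isomorphic, with identities on
   both ends, to a sequence in block form. *)
Definition short_exact Psi Gamma Phi (i : 'M[Kt]_(tdim Gamma, tdim Psi))
    (p : 'M[Kt]_(tdim Phi, tdim Gamma)) : Prop :=
  exists (Gamma' : tmodule) (i' : 'M[Kt]_(tdim Gamma', tdim Psi))
         (p' : 'M[Kt]_(tdim Phi, tdim Gamma')) (g : 'M[Kt]_(tdim Gamma', tdim Gamma)),
  [/\ block_exact i' p', is_iso g, g *m i = i' & p' *m g = p].

Definition tau_simple Gamma : Prop :=
  forall Psi Phi (i : 'M[Kt]_(tdim Gamma, tdim Psi))
    (p : 'M[Kt]_(tdim Phi, tdim Gamma)),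
  short_exact i p -> tdim Psi = 0%N \/ tdim Phi = 0%N.

(* A filtration 0 = M_0 c M_1 c ... c M_n = Gamma by tau-submodules, with
   inclusions inc_i : M_i -> M_(i+1) and quotients prj_i : M_(i+1) -> Q_i, so
   that Q_i (0 <= i < n) is M_(i+1) / M_i.  Only the indices up to n matter. *)
Record series (n : nat) Gamma := Series {
  smod : nat -> tmodule;
  squo : nat -> tmodule;
  sinc : forall i, 'M[Kt]_(tdim (smod i.+1), tdim (smod i));
  sprj : forall i, 'M[Kt]_(tdim (squo i), tdim (smod i.+1));
  sbot : tdim (smod 0) = 0%N;
  stop : smod n = Gamma;
  sexact : forall i, (i < n)%N -> short_exact (sinc i) (sprj i) }.

(* Every step of the filtration is literally in block form. *)
Definition in_block_form n Gamma (S : series n Gamma) : Prop :=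
  forall i, (i < n)%N -> block_exact (sinc S i) (sprj S i).

Section TReduction.

Variables Phi Psi : tmodule.

Local Notation d := (tdim Phi).
Local Notation e := (tdim Psi).
Local Notation idx := ('I_e * 'I_d)%type.

Implicit Types (W : 'M[Kt]_(e, d)) (U : idx -> 'M[K]_(e, d)) (N : idx -> nat).

(* W1 and W2 define the same class in Ext^1(Phi, Psi): the extensions given by
   the biderivations with values W1 and W2 at t are equivalent in the sense of
   Baer. *)
Definition same_ext W1 W2 : Prop :=
  exists h : 'M[Kt]_(d + e),
  [/\ h *m block_mx (Phi 'X) 0 W1 (Psi 'X) = block_mx (Phi 'X) 0 W2 (Psi 'X) *m h,
      h *m col_mx 0 1%:M = col_mx 0 1%:M :> 'M[Kt]_(d + e, e) &
      row_mx 1%:M 0 *m h = row_mx 1%:M 0 :> 'M[Kt]_(d, d + e)].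

Definition deg_lt N W : Prop := forall ij, (tsize (W ij.1 ij.2) <= N ij)%N.

(* c tau^k U_ij *)
Definition gen U (c : K) k (ij : idx) : 'M[Kt]_(e, d) :=
  tmon c k *: map_mx tconst (U ij).

(* c tau^k E_ij *)
Definition mono (c : K) k (ij : idx) : 'M[Kt]_(e, d) :=
  tmon c k *: delta_mx ij.1 ij.2.

(* the biderivation delta^(c tau^k U_ij), evaluated at t *)
Definition inner_gen U (c : K) k ij : 'M[Kt]_(e, d) :=
  inner (gen U c k ij) 'X.

(* W' is obtained from W by subtracting finitely many
   delta^(c_l tau^(k_l) U_(i_l, j_l)). *)
Definition reduces_to U W W' : Prop :=
  exists s : seq (K * nat * idx),
    W' = W - \sum_(x <- s) inner_gen U x.1.1 x.1.2 x.2.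

(* A finitely supported family c_(i,j,k) is encoded by the polynomials
   c_ij = \sum_k c_(i,j,k) 'X^k. *)
Definition condA U : Prop :=
  forall V : 'M[Kt]_(e, d), exists! c : 'M[{poly K}]_(e, d),
  forall a, inner V a =
    \sum_(ij : idx) \sum_(k < size (c ij.1 ij.2))
      inner (gen U (c ij.1 ij.2)`_k k ij) a.

Definition condB U : Prop :=
  forall ij k (c : K), c != 0 -> tlead (inner_gen U c k ij ij.1 ij.2) = c.

Definition degrees_of U N : Prop :=
  forall ij (c : K), c != 0 -> tsize (inner_gen U c 0 ij ij.1 ij.2) = (N ij).+1.

Definition condC U N : Prop :=
  forall delta : {poly F} -> 'M[Kt]_(e, d), biderivation delta ->
  exists2 W, reduces_to U (delta 'X) W & deg_lt N W.

Definition condD N : Prop :=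
  forall W1 W2, deg_lt N W1 -> deg_lt N W2 -> same_ext W1 W2 -> W1 = W2.

(* The reduction of c tau^k E_ij is carried out with c as a parameter: the
   coefficients c_l of the biderivations that are subtracted are values at c of
   twisted polynomials.  Without it, condA - condD only give a reduction for
   each individual c; e.g. over a perfect K, c_l could be a q-th root of c. *)
Definition uniform_reduction U N : Prop :=
  forall ij k, exists s : seq (Kt * nat * idx), forall c : K,
  deg_lt N (mono c k ij -
            \sum_(x <- s) inner_gen U (teval x.1.1 c) x.1.2 x.2).

(* the coordinates (i, j, k), k < N_ij, of the matrices W with deg_lt N W *)
Definition coord N := {ij : idx & 'I_(N ij)}.

(* Pi is the t-module t |-> Pi_t, its coordinates being indexed through f: the
   column of (i, j, k) gives the coordinates of the reduction of
   Psi_t c tau^k E_ij as values at c of twisted polynomials. *)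
Definition transfers_t U N (Pi : tmodule) (f : 'I_(tdim Pi) -> coord N) : Prop :=
  bijective f /\
  forall (y : 'I_(tdim Pi)) (c : K),
  reduces_to U (Psi 'X *m mono c (tagged (f y)) (tag (f y)))
    (\sum_(x : 'I_(tdim Pi))
       mono (teval (Pi 'X x y) c) (tagged (f x)) (tag (f x))).

(* Ext^1(Phi, Psi) has a t-module structure coming from t-reduction, in the
   given coordinates of Phi and Psi. *)
Definition t_reduction : Prop :=
  exists (U : idx -> 'M[K]_(e, d)) (N : idx -> nat),
    basis_of fullv (codom U) /\
    [/\ condA U, condB U, degrees_of U N, condC U N & condD N] /\
    uniform_reduction U N /\
    exists (Pi : tmodule) (f : 'I_(tdim Pi) -> coord N), transfers_t U f.

End TReduction.

(* The same up to isomorphism of Phi and Psi. *)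
Definition t_reduction_upto_iso Phi Psi : Prop :=
  exists Phi' Psi' : tmodule,
    [/\ isomorphic Phi Phi', isomorphic Psi Psi' & t_reduction Phi' Psi'].

End TModules.

(* Main.v *)
Require Import Defs.
From HB Require Import structures.
From mathcomp Require Import all_boot all_order all_algebra all_fingroup all_solvable all_field.

Set Implicit Arguments.
Unset Strict Implicit.
Unset Printing Implicit Defensive.

Import GRing.Theory.
Local Open Scope ring_scope.

(* Reducing modulo inner biderivations is a computation with the F_q-linear map
   L : U |-> U Phi_t - Psi_t U on matrices of twisted polynomials.  When Hom = 0,
   conditions A and D together say that the U_ij are a basis in the twisted sense
   and that L V has small degrees only for V = 0.  If Phi_t or Psi_t is block
   lower triangular, then so are L and multiplication by Psi_t, for the splitting
   of the columns, resp. rows; one reduces first the block that does not receive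
   anything from the other one, then the other block, to which the first step
   contributes an error term depending on the parameter c through twisted
   polynomials.  Hence t-reductions for the two diagonal blocks glue, and Pi_t is
   block lower triangular with the given Pi_t's on the diagonal, so its constant
   term is still theta plus a nilpotent matrix.  Induction along the composition
   series of both t-modules concludes. *)

(** * Twisted polynomials as additive polynomials, and families uniform in a parameter *)

Section TwistedPolynomialTheory.

Variables (F : finFieldType) (K : fieldType) (iota : {rmorphism {poly F} -> K}).

Local Notation q := #|F|%N.
Local Notation Kt := (tpoly iota).
Local Notation tmon := (tmon iota).
Local Notation tconst := (tconst iota).
Local Notation tsize := Defs.tsize.

Implicit Types (f g : Kt) (a b c : K).

Fact tcoef_is_zmod_morphism k : zmod_morphism (fun f => tcoef f k).
Proof. by move=> f g; rewrite /tcoef coefB. Qed.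

Fact tconst_is_zmod_morphism : zmod_morphism tconst.
Proof. by move=> a b; apply: val_inj; rewrite /= scalerBl. Qed.

Lemma tcoef0 k : tcoef (0 : Kt) k = 0. Proof. exact: coef0. Qed.

Lemma tcoefN f k : tcoef (- f) k = - tcoef f k. Proof. exact: coefN. Qed.

Lemma tcoef_sum I (r : seq I) (P : pred I) (G : I -> Kt) k :
  tcoef (\sum_(i <- r | P i) G i) k = \sum_(i <- r | P i) tcoef (G i) k.
Proof.
by apply: (big_morph (fun f => tcoef f k)) => [f g|]; rewrite (tcoefD, tcoef0).
Qed.

Lemma tcoef_tmon c k l : tcoef (tmon c k) l = if l == k then c else 0.
Proof. by rewrite /tcoef /= coefZ coefXn; case: eqP; rewrite (mulr1, mulr0). Qed.

Lemma tcoef_mon_mul a k g l :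
  tcoef (tmon a k * g) l = if (k <= l)%N then a * tcoef g (l - k) ^+ (q ^ k) else 0.
Proof.
rewrite tcoef_mul; case: leqP => [le_kl | lt_lk].
  rewrite (bigD1 (inord k)) //= big1 ?addr0 => [|i].
    by rewrite inordK ?ltnS // tcoef_tmon eqxx.
  rewrite tcoef_tmon -val_eqE /= inordK ?ltnS // => /negPf->.
  by rewrite mul0r.
apply: big1 => i _; rewrite tcoef_tmon ltn_eqF ?mul0r //.
exact: leq_trans (ltn_ord i) lt_lk.
Qed.

Lemma tmonM a b k l : tmon a k * tmon b l = tmon (a * b ^+ (q ^ k)) (k + l).
Proof.
apply: tpolyP => i; rewrite tcoef_mon_mul !tcoef_tmon.
case: leqP => [le_ki | lt_ik]; last first.
  by rewrite ltn_eqF // (leq_trans lt_ik) // leq_addr.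
rewrite -(eqn_add2l k) subnKC //; case: eqP => // _.
by rewrite expr0q mulr0.
Qed.

Lemma tmon0 k : tmon 0 k = 0.
Proof. by apply: val_inj; rewrite /= scale0r. Qed.

Lemma tmonN a k : tmon (- a) k = - tmon a k.
Proof. by apply: val_inj; rewrite /= scaleNr. Qed.

Lemma tmon10 : tmon 1 0 = 1.
Proof. by apply: val_inj; rewrite /= scale1r expr0. Qed.

Fact tconst_is_monoid_morphism : monoid_morphism tconst.
Proof.
by split=> [|a b]; rewrite ?[tconst 1]tmon10 // /Defs.tconst tmonM expn0 expr1.
Qed.

HB.instance Definition _ := GRing.isZmodMorphism.Build K Kt tconst
  tconst_is_zmod_morphism.
HB.instance Definition _ := GRing.isMonoidMorphism.Build K Kt tconst
  tconst_is_monoid_morphism.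

(** Reduction modulo tau. It is named so as to carry a ring morphism structure, through which it
    passes to matrix products. *)
Definition tangent f : K := tcoef f 0.

Fact tangent_is_monoid_morphism : monoid_morphism tangent.
Proof.
split=> [|f g]; first by rewrite -tmon10 /tangent tcoef_tmon.
by rewrite /tangent tcoef_mul big_ord1 expn0 expr1.
Qed.

HB.instance Definition _ := GRing.isZmodMorphism.Build Kt K tangent
  (tcoef_is_zmod_morphism 0).
HB.instance Definition _ := GRing.isMonoidMorphism.Build Kt K tangent
  tangent_is_monoid_morphism.

Lemma tangent_const a : tangent (tconst a) = a.
Proof. by rewrite /tangent tcoef_tmon. Qed.

Lemma tpoly_sum f n : (tsize f <= n)%N -> f = \sum_(k < n) tmon (tcoef f k) k.
Proof.
move=> le_fn; apply: tpolyP => k; rewrite tcoef_sum.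
have [lt_kn | le_nk] := ltnP k n; last first.
  rewrite [LHS]nth_default ?(leq_trans le_fn) // big1 // => i _.
  by rewrite tcoef_tmon gtn_eqF // (leq_trans (ltn_ord i)).
rewrite (bigD1 (Ordinal lt_kn)) //= tcoef_tmon eqxx big1 ?addr0 // => i.
by rewrite tcoef_tmon -val_eqE eq_sym /= => /negPf->.
Qed.

Lemma tsize_leP f n : reflect (forall k, (n <= k)%N -> tcoef f k = 0) (tsize f <= n)%N.
Proof. exact: leq_sizeP. Qed.

Lemma teval_wide f c n : (tsize f <= n)%N ->
  teval f c = \sum_(i < n) tcoef f i * c ^+ (q ^ i).
Proof.
move=> le_fn; rewrite /teval (big_ord_widen n (fun i => tcoef f i * c ^+ (q ^ i))) //.
rewrite big_mkcond; apply: eq_bigr => i _; case: ltnP => // le_fi.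
by rewrite [tcoef f i]nth_default // mul0r.
Qed.

Lemma tevalD f g c : teval (f + g) c = teval f c + teval g c.
Proof.
pose n := maxn (tsize f) (tsize g).
have lef : (tsize f <= n)%N by rewrite leq_maxl.
have leg : (tsize g <= n)%N by rewrite leq_maxr.
have lefg : (tsize (f + g)%R <= n)%N by exact: size_polyD.
rewrite !(@teval_wide _ _ n) // -big_split; apply: eq_bigr => i _ /=.
by rewrite tcoefD mulrDl.
Qed.

Lemma teval0 c : teval (0 : Kt) c = 0.
Proof. by rewrite /teval /tsize size_poly0 big_ord0. Qed.

Lemma tevalN f c : teval (- f) c = - teval f c.
Proof. by apply/eqP; rewrite -addr_eq0 -tevalD addNr teval0. Qed.

Lemma teval_sum I (r : seq I) (P : pred I) (G : I -> Kt) c :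
  teval (\sum_(i <- r | P i) G i) c = \sum_(i <- r | P i) teval (G i) c.
Proof.
by apply: (big_morph (fun f => teval f c)) => [f g|]; rewrite (tevalD, teval0).
Qed.

Lemma teval_tmon a k c : teval (tmon a k) c = a * c ^+ (q ^ k).
Proof.
rewrite (@teval_wide _ _ k.+1); last first.
  by apply/tsize_leP => l lt_kl; rewrite tcoef_tmon gtn_eqF.
rewrite big_ord_recr /= tcoef_tmon eqxx big1 ?add0r // => i _.
by rewrite tcoef_tmon ltn_eqF ?mul0r.
Qed.

Lemma teval1 c : teval (1 : Kt) c = c.
Proof. by rewrite -tmon10 teval_tmon expn0 expr1 mul1r. Qed.

(** With tau acting on K as the q-Frobenius, the rule tau u = u^q tau is the composition rule of
    additive polynomials; both sides are additive in f and g, so monomials suffice. *)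
Lemma tevalM f g c : teval (f * g) c = teval f (teval g c).
Proof.
rewrite {1}(tpoly_sum (leqnn (tsize f))) mulr_suml teval_sum.
apply: eq_bigr => i _; rewrite {1}(tpoly_sum (leqnn (tsize g))) mulr_sumr.
rewrite teval_sum [teval g c in RHS]/teval (exprq_sum iota) mulr_sumr.
apply: eq_bigr => j _.
by rewrite tmonM teval_tmon exprMn -exprM -expnD [(j + _)%N]addnC mulrA.
Qed.

(* Families of twisted polynomials whose coefficients are values at the
   parameter of twisted polynomials. *)
Definition unif (w : K -> Kt) : Prop :=
  exists s : seq (Kt * nat), forall c, w c = \sum_(x <- s) tmon (teval x.1 c) x.2.

Lemma eq_unif w w' : w =1 w' -> unif w -> unif w'.
Proof. by move=> eqw [s sP]; exists s => c; rewrite -eqw. Qed.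

Lemma unif0 : unif (fun=> 0).
Proof. by exists [::] => c; rewrite big_nil. Qed.

Lemma unifD w1 w2 : unif w1 -> unif w2 -> unif (fun c => w1 c + w2 c).
Proof. by move=> [s1 E1] [s2 E2]; exists (s1 ++ s2) => c; rewrite big_cat E1 E2. Qed.

Lemma unifN w : unif w -> unif (fun c => - w c).
Proof.
move=> [s E]; exists [seq (- x.1, x.2) | x <- s] => c.
by rewrite E big_map -sumrN; apply: eq_bigr => x _; rewrite /= tevalN tmonN.
Qed.

Lemma unif_sum (I : Type) (r : seq I) (w : I -> K -> Kt) :
  (forall i, unif (w i)) -> unif (fun c => \sum_(i <- r) w i c).
Proof.
move=> uw; elim: r => [|i r IHr].
  by apply: eq_unif unif0 => c; rewrite big_nil.
by apply: eq_unif (unifD (uw i) IHr) => c; rewrite big_cons.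
Qed.

Lemma unif_tmon g k : unif (fun c => tmon (teval g c) k).
Proof. by exists [:: (g, k)] => c; rewrite big_seq1. Qed.

(** Moving a tau^i to the left of a coefficient x(c) turns it into a x(c)^(q^i), the value at c of
    the twisted polynomial (a tau^i) x. *)
Lemma unif_mull f w : unif w -> unif (fun c => f * w c).
Proof.
case=> s E; apply: (@eq_unif (fun c => \sum_(i < tsize f) \sum_(x <- s)
    tmon (teval (tmon (tcoef f i) i * x.1) c) (i + x.2))) => [c|].
  rewrite E [in RHS](tpoly_sum (leqnn (tsize f))) mulr_suml; apply: eq_bigr => i _.
  by rewrite mulr_sumr; apply: eq_bigr => x _; rewrite tmonM tevalM teval_tmon.
by apply: unif_sum => i; apply: unif_sum => x; apply: unif_tmon.
Qed.

(** On this side the parameter is not touched by tau: each coefficient x(c) is only multiplied by a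
    constant of the commutative field K. *)
Lemma unif_mulr f w : unif w -> unif (fun c => w c * f).
Proof.
case=> s E; apply: (@eq_unif (fun c => \sum_(x <- s) \sum_(i < tsize f)
    tmon (teval (tconst (tcoef f i ^+ (q ^ x.2)) * x.1) c) (x.2 + i))) => [c|].
  rewrite E mulr_suml; apply: eq_bigr => x _.
  rewrite [in RHS](tpoly_sum (leqnn (tsize f))) mulr_sumr; apply: eq_bigr => i _.
  by rewrite tmonM tevalM teval_tmon expn0 expr1 mulrC.
by apply: unif_sum => x; apply: unif_sum => i; apply: unif_tmon.
Qed.

Lemma unif_coef w k : unif w -> exists g, forall c, tcoef (w c) k = teval g c.
Proof.
case=> s E; exists (\sum_(x <- s | x.2 == k) x.1) => c.
rewrite E tcoef_sum teval_sum [RHS]big_mkcond; apply: eq_bigr => x _ /=.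
by rewrite tcoef_tmon eq_sym.
Qed.

Lemma tsizeB f g n : (tsize f <= n -> tsize g <= n -> tsize (f - g)%R <= n)%N.
Proof.
move=> /tsize_leP le_f /tsize_leP le_g; apply/tsize_leP => k le_nk.
by rewrite tcoefD tcoefN le_f ?le_g ?subr0.
Qed.

End TwistedPolynomialTheory.

(** Powers stay block lower triangular, with the powers of A and B on the diagonal. The power k + l
    kills both diagonal blocks, and its square vanishes. *)
Lemma block_lower_nilpotent (R : pzRingType) n1 n2 (A : 'M[R]_n1) (B : 'M[R]_n2) C :
  (exists k, A ^+ k = 0) -> (exists k, B ^+ k = 0) ->
  exists k, (block_mx A 0 C B : 'M_(n1 + n2)) ^+ k = 0.
Proof.
move=> [k Ak] [l Bl].
have blockX m : exists D, (block_mx A 0 C B : 'M_(n1 + n2)) ^+ m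
                          = block_mx (A ^+ m) 0 D (B ^+ m).
  elim: m => [|m [D E]]; first by exists 0; rewrite !expr0 -scalar_mx_block.
  rewrite !exprS E; exists (C *m A ^+ m + B *m D).
  by rewrite [LHS]mulmx_block !mul0mx !mulmx0 !addr0 add0r.
have [D E] := blockX (k + l)%N; exists (k + l + (k + l))%N.
rewrite exprD E exprD Ak mul0r exprD Bl mulr0 [LHS]mulmx_block.
by rewrite !mul0mx !mulmx0 !addr0 block_mx0.
Qed.

(** * Uniform families of matrices, and t-reduction for abstract additive maps *)

Section Reductions.

Variables (F : finFieldType) (K : fieldType) (iota : {rmorphism {poly F} -> K}).

Local Notation Kt := (tpoly iota).
Local Notation tmon := (tmon iota).
Local Notation tconst := (tconst iota).
Local Notation tangent := (@tangent F K iota).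
Local Notation tsize := Defs.tsize.
Local Notation idx e d := ('I_e * 'I_d)%type.

Section FixedDimensions.

Variables e d : nat.
Implicit Types (U : idx e d -> 'M[K]_(e, d)) (N : idx e d -> nat).

Definition unifm (W : K -> 'M[Kt]_(e, d)) : Prop :=
  forall i j, unif (fun c => W c i j).

Lemma eq_unifm W1 W2 : W1 =1 W2 -> unifm W1 -> unifm W2.
Proof. by move=> eqW uW i j; apply: eq_unif (uW i j) => c; rewrite eqW. Qed.

Lemma unifm0 : unifm (fun=> 0).
Proof. by move=> i j; apply: eq_unif (@unif0 _ _ iota) => c; rewrite mxE. Qed.

Lemma unifmD W1 W2 : unifm W1 -> unifm W2 -> unifm (fun c => W1 c + W2 c).
Proof.
by move=> u1 u2 i j; apply: eq_unif (unifD (u1 i j) (u2 i j)) => c; rewrite mxE.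
Qed.

Lemma unifmB W1 W2 : unifm W1 -> unifm W2 -> unifm (fun c => W1 c - W2 c).
Proof.
move=> u1 u2 i j.
by apply: eq_unif (unifD (u1 i j) (unifN (u2 i j))) => c; rewrite !mxE.
Qed.

Lemma unifm_sum (I : Type) (r : seq I) (W : I -> K -> 'M[Kt]_(e, d)) :
  (forall i, unifm (W i)) -> unifm (fun c => \sum_(i <- r) W i c).
Proof.
by move=> uW i j; apply: eq_unif (unif_sum r (fun l => uW l i j)) => c; rewrite summxE.
Qed.

(** This and [mono_mx] are [gen] and [mono] detached from t-modules, so that they make sense on the
    blocks of a matrix. *)
Definition scal_mx c k (A : 'M[K]_(e, d)) : 'M[Kt]_(e, d) := tmon c k *: map_mx tconst A.

Definition mono_mx c k (ij : idx e d) : 'M[Kt]_(e, d) := tmon c k *: delta_mx ij.1 ij.2.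

Lemma unifm_scal (g : Kt) k A : unifm (fun c => scal_mx (teval g c) k A).
Proof.
move=> i j; apply: eq_unif (unif_mulr (tconst (A i j)) (unif_tmon g k)) => c.
by rewrite !mxE.
Qed.

Lemma unifm_mono (g : Kt) k ij : unifm (fun c => mono_mx (teval g c) k ij).
Proof.
move=> i j; pose b := (delta_mx ij.1 ij.2 : 'M[Kt]_(e, d)) i j.
by apply: eq_unif (unif_mulr b (unif_tmon g k)) => c; rewrite /b !mxE.
Qed.

Lemma matrix_sum_idx (W : 'M[Kt]_(e, d)) : W = \sum_ij W ij.1 ij.2 *: delta_mx ij.1 ij.2.
Proof. by rewrite {1}(matrix_sum_delta W) pair_big. Qed.

Definition comb U (c : 'M[{poly K}]_(e, d)) : 'M[Kt]_(e, d) :=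
  \sum_(ij : idx e d) \sum_(k < size (c ij.1 ij.2)) scal_mx (c ij.1 ij.2)`_k k (U ij).

(** Condition A pulled back along V |-> delta^(V); the two agree when this map is injective, that
    is, when Hom = 0. *)
Definition scal_basis U : Prop := forall V : 'M[Kt]_(e, d), exists! c, V = comb U c.

Definition degm N (W : 'M[Kt]_(e, d)) : Prop :=
  forall ij, (tsize (W ij.1 ij.2) <= N ij)%N.

Lemma degmB N V W : degm N V -> degm N W -> degm N (V - W).
Proof. by move=> dV dW ij; rewrite !mxE tsizeB. Qed.

Lemma degmD N V W : degm N V -> degm N W -> degm N (V + W).
Proof.
move=> dV dW; rewrite -[W]opprK; apply: degmB => // ij.
rewrite mxE; apply/tsize_leP => k /(tsize_leP _ _ (dW ij)).
by rewrite tcoefN => ->; rewrite oppr0.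
Qed.

Lemma degm0 N : degm N 0.
Proof. by move=> ij; rewrite mxE /Defs.tsize size_poly0. Qed.

Definition unif_comb U (V : K -> 'M[Kt]_(e, d)) : Prop :=
  exists s : seq (Kt * nat * idx e d), forall c,
    V c = \sum_(x <- s) scal_mx (teval x.1.1 c) x.1.2 (U x.2).

(** Uniform families are finite sums of families g(c) tau^k E_ij, so additive statements about them
    need only be checked on these. *)
Lemma unifm_ind (Q : (K -> 'M[Kt]_(e, d)) -> Prop) :
  (forall W1 W2, W1 =1 W2 -> Q W1 -> Q W2) -> Q (fun=> 0) ->
  (forall W1 W2, Q W1 -> Q W2 -> Q (fun c => W1 c + W2 c)) ->
  (forall (g : Kt) k ij, Q (fun c => mono_mx (teval g c) k ij)) ->
  forall W, unifm W -> Q W.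
Proof.
move=> eqQ Q0 QD Qmon W uW.
have Qsum (I : Type) (r : seq I) (V : I -> K -> 'M[Kt]_(e, d)) :
    (forall i, Q (V i)) -> Q (fun c => \sum_(i <- r) V i c).
  move=> QV; elim: r => [|i r IHr].
    by apply: eqQ Q0 => c; rewrite big_nil.
  by apply: eqQ (QD _ _ (QV i) IHr) => c; rewrite big_cons.
apply: (eqQ (fun c => \sum_ij W c ij.1 ij.2 *: delta_mx ij.1 ij.2)) => [c|].
  by rewrite -matrix_sum_idx.
apply: (Qsum) => -[i j] /=; have [s E] := uW i j.
apply: (eqQ (fun c => \sum_(x <- s) mono_mx (teval x.1 c) x.2 (i, j))) => [c|].
  by rewrite E scaler_suml.
by apply: Qsum => x; apply: Qmon.
Qed.

(** Each tau^k E_ij is expanded in the twisted basis once and for all, independently of c;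
    multiplying that expansion on the left by the constant g(c) keeps the coefficients uniform. *)
Lemma unifm_comb U V : scal_basis U -> unifm V -> unif_comb U V.
Proof.
move=> basU; move: V; apply: unifm_ind => [W1 W2 eqW [s E]||W1 W2 [s E] [t E']|g k ij].
- by exists s => c; rewrite -eqW.
- by exists [::] => c; rewrite big_nil.
- by exists (s ++ t) => c; rewrite big_cat /= E E'.
have [p [Ep _]] := basU (mono_mx 1 k ij).
exists (flatten [seq [seq (tconst (p y.1 y.2)`_l * g, l, y)
  | l <- seq.iota 0 (size (p y.1 y.2))] | y <- enum {: idx e d}]) => c.
transitivity (tconst (teval g c) *: mono_mx 1 k ij).
  by rewrite scalerA tmonM expr1n mulr1 add0n.
rewrite Ep /comb scaler_sumr big_flatten big_map big_enum; apply: eq_bigr => y _.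
rewrite scaler_sumr big_map -[size _ in RHS]subn0 big_mkord.
apply: eq_bigr => l _.
by rewrite scalerA tmonM tevalM teval_tmon expn0 !expr1 mulrC.
Qed.

Lemma unif_coords N n (g : 'I_n -> idx e d * nat) R :
  injective g -> (forall ij k, ((ij, k) \in codom g) = (k < N ij)%N) ->
  unifm R -> (forall c, degm N (R c)) ->
  exists p : 'I_n -> Kt, forall c, R c = \sum_x mono_mx (teval (p x) c) (g x).2 (g x).1.
Proof.
move=> injg codg uR dR.
have coefR x : exists p : Kt, forall c,
    tcoef (R c (g x).1.1 (g x).1.2) (g x).2 = teval p c.
  exact: unif_coef.
have [p pP] := fin_all_exists coefR.
exists p => c; apply/matrixP => i j; apply: tpolyP => k.
rewrite summxE tcoef_sum.
(* The coefficient of tau^k at (i, j) isolates the only x with g x = ((i, j), k). If there is none,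
   then k is at least N_ij and the coefficient of R c vanishes as well. *)
have coefE x : tcoef (mono_mx (teval (p x) c) (g x).2 (g x).1 i j) k =
    if g x == ((i, j), k) then tcoef (R c i j) k else 0.
  rewrite -pP; case: (g x) => [[i' j'] k'] /=; rewrite !mxE !xpair_eqE /=.
  rewrite [i == i']eq_sym [j == j']eq_sym.
  case: eqP => [->|_]; last by rewrite /= mulr0 tcoef0.
  case: eqP => [->|_]; last by rewrite /= mulr0 tcoef0.
  by rewrite /= mulr1 tcoef_tmon eq_sym; case: eqP => // ->.
under eq_bigr do rewrite coefE.
have [lt_kN | le_Nk] := ltnP k (N (i, j)).
  move: lt_kN; rewrite -codg => /codomP[x Ex].
  rewrite (bigD1 x) //= -Ex eqxx big1 ?addr0 // => y /negPf neq_yx.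
  by rewrite Ex (inj_eq injg) neq_yx.
rewrite -big_mkcond big1; last first.
  move=> x /eqP Ex; have := codg (i, j) k.
  by rewrite -Ex codom_f ltnNge le_Nk.
exact: (tsize_leP _ _ (dR c (i, j))).
Qed.

Lemma mono_mxE c k x y : mono_mx c k x y.1 y.2 = if y == x then tmon c k else 0.
Proof.
rewrite !mxE [y]surjective_pairing [x]surjective_pairing xpair_eqE /=.
by case: andP; rewrite (mulr1, mulr0).
Qed.

Lemma degm_coords N n (g : 'I_n -> idx e d * nat) (a : 'I_n -> K) :
  (forall ij k, ((ij, k) \in codom g) = (k < N ij)%N) ->
  degm N (\sum_x mono_mx (a x) (g x).2 (g x).1).
Proof.
move=> codg ij; apply/tsize_leP => k le_Nk; rewrite summxE tcoef_sum big1 // => x _.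
rewrite mono_mxE; case: eqP => [Eij|_]; last by rewrite tcoef0.
rewrite tcoef_tmon gtn_eqF // (leq_trans _ le_Nk) // -codg Eij.
by rewrite -surjective_pairing codom_f.
Qed.

(* L stands for U |-> U Phi_t - Psi_t U and T for multiplication by Psi_t. *)
Definition reduction (L T : 'M[Kt]_(e, d) -> 'M[Kt]_(e, d)) : Prop :=
  exists (U : idx e d -> 'M[K]_(e, d)) (N : idx e d -> nat),
  [/\ scal_basis U,
      forall ij k c, c != 0 -> tlead (L (scal_mx c k (U ij)) ij.1 ij.2) = c,
      forall ij c, c != 0 -> tsize (L (scal_mx c 0 (U ij)) ij.1 ij.2) = (N ij).+1,
      forall V, degm N (L V) -> V = 0 &
      forall W, unifm W -> exists2 V, unifm V & forall c, degm N (W c - L (V c))] /\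
  exists n (P : 'M[Kt]_n) (g : 'I_n -> idx e d * nat),
  [/\ injective g,
      forall ij k, ((ij, k) \in codom g) = (k < N ij)%N,
      exists k, (map_mx tangent P - (iota 'X)%:M) ^+ k = 0 &
      forall y c, exists V, T (mono_mx c (g y).2 (g y).1) - L V =
        \sum_x mono_mx (teval (P x y) c) (g x).2 (g x).1].

End FixedDimensions.

Lemma unifm_mull e e' d (A : 'M[Kt]_(e', e)) (W : K -> 'M[Kt]_(e, d)) :
  unifm W -> unifm (fun c => A *m W c).
Proof.
move=> uW i j; apply: (@eq_unif _ _ _ (fun c => \sum_l A i l * W c l j)) => [c|].
  by rewrite mxE.
by apply: unif_sum => l; apply: unif_mull.
Qed.

Lemma unifm_mulr e d d' (A : 'M[Kt]_(d, d')) (W : K -> 'M[Kt]_(e, d)) :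
  unifm W -> unifm (fun c => W c *m A).
Proof.
move=> uW i j; apply: (@eq_unif _ _ _ (fun c => \sum_l W c i l * A l j)) => [c|].
  by rewrite mxE.
by apply: unif_sum => l; apply: unif_mulr.
Qed.

End Reductions.

(** * Gluing the reductions of two blocks *)

Section Glue.

Variables (F : finFieldType) (K : fieldType) (iota : {rmorphism {poly F} -> K}).

Local Notation Kt := (tpoly iota).
Local Notation idx e d := ('I_e * 'I_d)%type.
Local Notation emon := (mono_mx iota).
Local Notation scal := (scal_mx iota).

(* The positions of an e x d matrix are split by [split_idx] into those of an
   e1 x d1 and those of an e2 x d2 matrix; this covers both the splitting of
   the rows and that of the columns. *)
Variables (e d e1 d1 e2 d2 : nat).
Variables (split_idx : idx e d -> idx e1 d1 + idx e2 d2)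
  (h1 : idx e1 d1 -> idx e d) (h2 : idx e2 d2 -> idx e d).
Hypotheses (split_h1 : forall x, split_idx (h1 x) = inl x)
  (split_h2 : forall x, split_idx (h2 x) = inr x)
  (unsplit_idx : forall ij,
     match split_idx ij with inl x => h1 x | inr x => h2 x end = ij).

Definition jn (R : Type) (A : 'M[R]_(e1, d1)) (B : 'M[R]_(e2, d2)) : 'M[R]_(e, d) :=
  \matrix_(i, j) match split_idx (i, j) with
                 | inl x => A x.1 x.2 | inr x => B x.1 x.2 end.

Definition res1 (R : Type) (V : 'M[R]_(e, d)) : 'M[R]_(e1, d1) :=
  \matrix_(i, j) V (h1 (i, j)).1 (h1 (i, j)).2.

Definition res2 (R : Type) (V : 'M[R]_(e, d)) : 'M[R]_(e2, d2) :=
  \matrix_(i, j) V (h2 (i, j)).1 (h2 (i, j)).2.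

Lemma jnE1 R (A : 'M[R]_(e1, d1)) B x : jn A B (h1 x).1 (h1 x).2 = A x.1 x.2.
Proof. by rewrite mxE -surjective_pairing split_h1. Qed.

Lemma jnE2 R A (B : 'M[R]_(e2, d2)) x : jn A B (h2 x).1 (h2 x).2 = B x.1 x.2.
Proof. by rewrite mxE -surjective_pairing split_h2. Qed.

Lemma res1_jn R (A : 'M[R]_(e1, d1)) B : res1 (jn A B) = A.
Proof. by apply/matrixP => i j; rewrite mxE jnE1. Qed.

Lemma res2_jn R A (B : 'M[R]_(e2, d2)) : res2 (jn A B) = B.
Proof. by apply/matrixP => i j; rewrite mxE jnE2. Qed.

Lemma jn_res R (V : 'M[R]_(e, d)) : jn (res1 V) (res2 V) = V.
Proof.
apply/matrixP => i j; rewrite mxE -[RHS]/(V (i, j).1 (i, j).2).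
rewrite -[in RHS](unsplit_idx (i, j)).
by case: (split_idx (i, j)) => x; rewrite mxE -surjective_pairing.
Qed.

Lemma jn_inj R (A A' : 'M[R]_(e1, d1)) B B' : jn A B = jn A' B' -> A = A' /\ B = B'.
Proof.
move=> E; split; first by rewrite -(res1_jn A B) E res1_jn.
by rewrite -(res2_jn A B) E res2_jn.
Qed.

Lemma jnB (R : zmodType) (A A' : 'M[R]_(e1, d1)) B B' :
  jn (A - A') (B - B') = jn A B - jn A' B'.
Proof. by apply/matrixP => i j; rewrite !mxE; case: split_idx => x; rewrite !mxE. Qed.

Lemma jnD (R : zmodType) (A A' : 'M[R]_(e1, d1)) B B' :
  jn (A + A') (B + B') = jn A B + jn A' B'.
Proof. by apply/matrixP => i j; rewrite !mxE; case: split_idx => x; rewrite !mxE. Qed.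

Lemma jn0 (R : zmodType) : jn 0 0 = 0 :> 'M[R]_(e, d).
Proof. by apply/matrixP => i j; rewrite !mxE; case: split_idx => x; rewrite !mxE. Qed.

Lemma jn_sum1 (R : zmodType) I (r : seq I) (A : I -> 'M[R]_(e1, d1)) :
  \sum_(i <- r) jn (A i) 0 = jn (\sum_(i <- r) A i) 0.
Proof.
elim: r => [|i r IHr]; rewrite ?big_nil ?jn0 // !big_cons IHr -jnD.
by rewrite addr0.
Qed.

Lemma jn_sum2 (R : zmodType) I (r : seq I) (B : I -> 'M[R]_(e2, d2)) :
  \sum_(i <- r) jn 0 (B i) = jn 0 (\sum_(i <- r) B i).
Proof.
elim: r => [|i r IHr]; rewrite ?big_nil ?jn0 // !big_cons IHr -jnD.
by rewrite addr0.
Qed.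

Lemma jn_scal c k A B : scal c k (jn A B) = jn (scal c k A) (scal c k B).
Proof. by apply/matrixP => i j; rewrite !mxE; case: split_idx => x; rewrite !mxE. Qed.

Lemma scal0 n m c k : scal c k (0 : 'M_(n, m)) = 0.
Proof. by rewrite /scal_mx map_mx0 scaler0. Qed.

Lemma h1_eq x y : (h1 x == h1 y) = (x == y).
Proof. by apply/eqP/eqP => [E|-> //]; have := split_h1 x; rewrite E split_h1 => -[]. Qed.

Lemma h2_eq x y : (h2 x == h2 y) = (x == y).
Proof. by apply/eqP/eqP => [E|-> //]; have := split_h2 x; rewrite E split_h2 => -[]. Qed.

Lemma h12_neq x y : (h1 x == h2 y) = false.
Proof. by apply/eqP => E; have := split_h1 x; rewrite E split_h2. Qed.

Lemma jn_mono1 c k x : emon c k (h1 x) = jn (emon c k x) 0.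
Proof.
rewrite -[LHS]jn_res; congr jn; apply/matrixP => i j; rewrite mxE mono_mxE.
  by rewrite h1_eq -[RHS]/(emon c k x (i, j).1 (i, j).2) mono_mxE.
by rewrite eq_sym h12_neq mxE.
Qed.

Lemma jn_mono2 c k x : emon c k (h2 x) = jn 0 (emon c k x).
Proof.
rewrite -[LHS]jn_res; congr jn; apply/matrixP => i j; rewrite mxE mono_mxE.
  by rewrite h12_neq mxE.
by rewrite h2_eq -[RHS]/(emon c k x (i, j).1 (i, j).2) mono_mxE.
Qed.

Lemma sum_idx (V : nmodType) (G : idx e d -> V) :
  \sum_ij G ij = \sum_x G (h1 x) + \sum_x G (h2 x).
Proof.
rewrite (reindex (fun y => match y with inl x => h1 x | inr x => h2 x end)) /=.
  by rewrite big_sumType.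
by exists split_idx => [[x|x]|ij] _; rewrite ?split_h1 ?split_h2.
Qed.

Definition jn_basis (U1 : idx e1 d1 -> 'M[K]_(e1, d1)) (U2 : idx e2 d2 -> 'M[K]_(e2, d2))
    (ij : idx e d) : 'M[K]_(e, d) :=
  match split_idx ij with inl x => jn (U1 x) 0 | inr x => jn 0 (U2 x) end.

Definition jn_bound (N1 : idx e1 d1 -> nat) (N2 : idx e2 d2 -> nat)
    (ij : idx e d) : nat :=
  match split_idx ij with inl x => N1 x | inr x => N2 x end.

Lemma jn_comb U1 U2 c1 c2 :
  comb iota (jn_basis U1 U2) (jn c1 c2) = jn (comb iota U1 c1) (comb iota U2 c2).
Proof.
rewrite -[in RHS](addr0 (comb _ U1 _)) -[in RHS](add0r (comb _ U2 _)) jnD.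
rewrite /comb sum_idx; congr (_ + _).
  rewrite -jn_sum1; apply: eq_bigr => x _; rewrite -jn_sum1 jnE1.
  by apply: eq_bigr => k _; rewrite /jn_basis split_h1 jn_scal scal0.
rewrite -jn_sum2; apply: eq_bigr => x _; rewrite -jn_sum2 jnE2.
by apply: eq_bigr => k _; rewrite /jn_basis split_h2 jn_scal scal0.
Qed.

Lemma jn_scal_basis U1 U2 :
  scal_basis iota U1 -> scal_basis iota U2 -> scal_basis iota (jn_basis U1 U2).
Proof.
move=> bas1 bas2 V.
have [c1 [E1 uniq1]] := bas1 (res1 V); have [c2 [E2 uniq2]] := bas2 (res2 V).
exists (jn c1 c2); split=> [|c]; first by rewrite jn_comb -E1 -E2 jn_res.
rewrite -(jn_res c) jn_comb -{1}(jn_res V) => /jn_inj[/uniq1-> /uniq2->] //.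
Qed.

Lemma jn_degm N1 N2 (A : 'M[Kt]_(e1, d1)) (B : 'M[Kt]_(e2, d2)) :
  degm (jn_bound N1 N2) (jn A B) <-> degm N1 A /\ degm N2 B.
Proof.
split=> [dAB | [dA dB] ij]; last first.
  rewrite mxE -surjective_pairing /jn_bound.
  by case: split_idx => x; rewrite ?dA ?dB.
split=> x; first by have := dAB (h1 x); rewrite jnE1 /jn_bound split_h1.
by have := dAB (h2 x); rewrite jnE2 /jn_bound split_h2.
Qed.

Lemma unifm_jn (A : K -> 'M[Kt]_(e1, d1)) B :
  unifm A -> unifm B -> unifm (fun c => jn (A c) (B c)).
Proof.
move=> uA uB i j; case E: (split_idx (i, j)) => [x|x].
  by apply: eq_unif (uA x.1 x.2) => c; rewrite mxE E.
by apply: eq_unif (uB x.1 x.2) => c; rewrite mxE E.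
Qed.

Lemma unifm_res1 (V : K -> 'M[Kt]_(e, d)) : unifm V -> unifm (fun c => res1 (V c)).
Proof.
by move=> uV i j; apply: eq_unif (uV (h1 (i, j)).1 (h1 (i, j)).2) => c; rewrite mxE.
Qed.

Lemma unifm_res2 (V : K -> 'M[Kt]_(e, d)) : unifm V -> unifm (fun c => res2 (V c)).
Proof.
by move=> uV i j; apply: eq_unif (uV (h2 (i, j)).1 (h2 (i, j)).2) => c; rewrite mxE.
Qed.

Variables (L T : {additive 'M[Kt]_(e, d) -> 'M[Kt]_(e, d)})
  (L1 T1 : {additive 'M[Kt]_(e1, d1) -> 'M[Kt]_(e1, d1)})
  (L2 T2 : {additive 'M[Kt]_(e2, d2) -> 'M[Kt]_(e2, d2)}).
Hypotheses (unifL : forall V, unifm V -> unifm (fun c => L (V c)))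
  (unifT : forall V, unifm V -> unifm (fun c => T (V c)))
  (L_res1 : forall V, res1 (L V) = L1 (res1 V))
  (T_res1 : forall V, res1 (T V) = T1 (res1 V))
  (L_jn2 : forall B, L (jn 0 B) = jn 0 (L2 B))
  (T_jn2 : forall B, T (jn 0 B) = jn 0 (T2 B)).

(** L is block lower triangular by [L_res1] and [L_jn2]; the last summand, the image of A in the
    second block, is the error term of the gluing. *)
Lemma L_jn A B : L (jn A B) = jn (L1 A) (L2 B + res2 (L (jn A 0))).
Proof.
have -> : jn A B = jn A 0 + jn 0 B by rewrite -jnD addr0 add0r.
rewrite raddfD /= L_jn2 -[L (jn A 0)]jn_res L_res1 -jnD res1_jn res2_jn.
by rewrite addr0 addrC.
Qed.

(** The error term is uniform in c because L and [res2] preserve uniformity. This is why reductions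
    are required for all uniform families and not only for monomials. *)
Lemma reduction_glue : reduction L1 T1 -> reduction L2 T2 -> reduction L T.
Proof.
move=> [U1 [N1 [[bas1 lead1 deg1 sep1 unif1] [n1 [P1 [g1 [injg1 codg1 nilp1 trans1]]]]]]].
move=> [U2 [N2 [[bas2 lead2 deg2 sep2 unif2] [n2 [P2 [g2 [injg2 codg2 nilp2 trans2]]]]]]].
pose U := jn_basis U1 U2; pose N := jn_bound N1 N2.
(* The entry (i, j) lies in the same block as U_ij, so the error term never meets the leading
   coefficients and degrees. *)
have LU ij k c : L (scal c k (U ij)) ij.1 ij.2 =
    match split_idx ij with
    | inl x => L1 (scal c k (U1 x)) x.1 x.2
    | inr x => L2 (scal c k (U2 x)) x.1 x.2 end.
  rewrite -{2 3}(unsplit_idx ij) /U /jn_basis; case: split_idx => x.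
    by rewrite jn_scal scal0 L_jn jnE1.
  by rewrite jn_scal scal0 L_jn2 jnE2.
(* The first block of V vanishes first, which removes the error term from the second. *)
have sepL V : degm N (L V) -> V = 0.
  rewrite -(jn_res V) L_jn => /jn_degm[/sep1 V1_0]; rewrite V1_0 jn0 raddf0.
  have -> : res2 (0 : 'M[Kt]_(e, d)) = 0 by rewrite -jn0 res2_jn.
  by rewrite addr0 => /sep2->; rewrite jn0.
exists U, N; split.
  split=> //; first exact: jn_scal_basis.
  - move=> ij k c c0; rewrite LU; case: split_idx => x; first exact: lead1.
    exact: lead2.
  - move=> ij c c0; rewrite LU /N /jn_bound; case: split_idx => x; first exact: deg1.
    exact: deg2.
  move=> W uW; have [V1 uV1 dV1] := unif1 _ (unifm_res1 uW).
  have uV10 : unifm (fun c => jn (V1 c) 0) by apply: unifm_jn => //; apply: unifm0.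
  (* The second block is reduced after subtracting the error caused by V1. *)
  have [V2 uV2 dV2] := unif2 _ (unifmB (unifm_res2 uW) (unifm_res2 (unifL uV10))).
  exists (fun c => jn (V1 c) (V2 c)) => [|c]; first exact: unifm_jn.
  rewrite L_jn -{1}(jn_res (W c)) -jnB; apply/jn_degm; split=> //.
  by rewrite [L2 _ + _]addrC opprD addrA.
(* Q will be the lower left block of Pi_t: the second-block coordinates of the reduction of T
   applied to a first-block monomial. *)
have /fin_all_exists[Q QP] : forall y : 'I_n1, exists p : 'I_n2 -> Kt, forall c,
    exists V, T (emon c (g1 y).2 (h1 (g1 y).1)) - L V =
      jn (\sum_x emon (teval (P1 x y) c) (g1 x).2 (g1 x).1)
         (\sum_x emon (teval (p x) c) (g2 x).2 (g2 x).1).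
  move=> y; pose m c := emon c (g1 y).2 (h1 (g1 y).1).
  have um : unifm m.
    by apply: eq_unifm (unifm_mono 1 _ _) => c; rewrite teval1.
  have [V1 uV1 dV1] := unif1 _ (unifm_res1 (unifT um)).
  have uV10 : unifm (fun c => jn (V1 c) 0) by apply: unifm_jn => //; apply: unifm0.
  have [V2 uV2 dV2] := unif2 _ (unifmB (unifm_res2 (unifT um)) (unifm_res2 (unifL uV10))).
  pose R c := T (m c) - L (jn (V1 c) (V2 c)).
  have RE c : R c = jn (T1 (emon c (g1 y).2 (g1 y).1) - L1 (V1 c))
      (res2 (T (m c)) - res2 (L (jn (V1 c) 0)) - L2 (V2 c)).
    rewrite /R -{1}(jn_res (T (m c))) L_jn -jnB T_res1 /m jn_mono1 res1_jn.
    by congr jn; rewrite [L2 _ + _]addrC opprD addrA.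
  have uR2 : unifm (fun c => res2 (R c)).
    by apply/unifm_res2/unifmB; [apply: unifT | apply/unifL/unifm_jn].
  have dR2 c : degm N2 (res2 (R c)) by rewrite RE res2_jn.
  have [p pP] := unif_coords injg2 codg2 uR2 dR2.
  exists p => c; exists (jn (V1 c) (V2 c)); rewrite -pP -[LHS](jn_res (R c)).
  congr jn; rewrite RE res1_jn; have [V' EV'] := trans1 y c; rewrite -EV'.
  (* The V' of a t-reduction may depend on c arbitrarily, but by uniqueness of
     reductions it is the uniform V1 c. *)
  congr (_ - L1 _); apply/eqP; rewrite -subr_eq0; apply/eqP/sep1.
  have -> : L1 (V1 c - V') = (T1 (emon c (g1 y).2 (g1 y).1) - L1 V')
      - (T1 (emon c (g1 y).2 (g1 y).1) - L1 (V1 c)).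
    by rewrite raddfB opprB [RHS]addrC addrA subrK.
  apply: degmB; first by rewrite EV'; apply: degm_coords.
  by have := dV1 c; rewrite T_res1 /m jn_mono1 res1_jn.
pose g (y : 'I_(n1 + n2)) : idx e d * nat := match split y with
  | inl z => (h1 (g1 z).1, (g1 z).2) | inr z => (h2 (g2 z).1, (g2 z).2) end.
have gl z : g (lshift n2 z) = (h1 (g1 z).1, (g1 z).2).
  by rewrite /g (unsplitK (inl z)).
have gr z : g (rshift n1 z) = (h2 (g2 z).1, (g2 z).2).
  by rewrite /g (unsplitK (inr z)).
(* Q takes the column index first, hence the exchange of i and j. *)
pose P := block_mx P1 0 (\matrix_(i, j) Q j i) P2.
exists (n1 + n2)%N, P, g; split.
- move=> x y; rewrite -(splitK x) -(splitK y).
  case: (split x) => x'; case: (split y) => y' /=; rewrite ?gl ?gr => -[].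
  + move=> /eqP; rewrite h1_eq => /eqP E1 E2; congr lshift; apply: injg1.
    by rewrite [LHS]surjective_pairing E1 E2 -surjective_pairing.
  + by move=> /eqP; rewrite h12_neq.
  + by move=> /eqP; rewrite eq_sym h12_neq.
  move=> /eqP; rewrite h2_eq => /eqP E1 E2; congr rshift; apply: injg2.
  by rewrite [LHS]surjective_pairing E1 E2 -surjective_pairing.
- move=> ij k; rewrite -(unsplit_idx ij) /N /jn_bound.
  case: (split_idx ij) => x; rewrite ?split_h1 ?split_h2 -?codg1 -?codg2.
    apply/codomP/codomP => [[y]|[z Ez]].
      rewrite -(splitK y); case: (split y) => z /=; rewrite ?gl ?gr => -[/eqP].
        by rewrite h1_eq => /eqP-> ->; exists z; rewrite -surjective_pairing.
      by rewrite h12_neq.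
    by exists (lshift n2 z); rewrite gl -Ez.
  apply/codomP/codomP => [[y]|[z Ez]].
    rewrite -(splitK y); case: (split y) => z /=; rewrite ?gl ?gr => -[/eqP].
      by rewrite eq_sym h12_neq.
    by rewrite h2_eq => /eqP-> ->; exists z; rewrite -surjective_pairing.
  by exists (rshift n1 z); rewrite gr -Ez.
- rewrite map_block_mx scalar_mx_block opp_block_mx add_block_mx map_mx0 oppr0 addr0.
  exact: block_lower_nilpotent.
have glueE y c : \sum_x emon (teval (P x y) c) (g x).2 (g x).1 =
    jn (\sum_x emon (teval (P (lshift n2 x) y) c) (g1 x).2 (g1 x).1)
       (\sum_x emon (teval (P (rshift n1 x) y) c) (g2 x).2 (g2 x).1).
  rewrite big_split_ord /= -[X in jn X _]addr0 -[X in jn _ X]add0r jnD.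
  rewrite -jn_sum1 -jn_sum2; congr (_ + _); apply: eq_bigr => x _.
    by rewrite gl jn_mono1.
  by rewrite gr jn_mono2.
move=> y c; rewrite glueE -(splitK y); case: (split y) => z; rewrite /= ?gl ?gr /=.
  have [V EV] := QP z c; exists V; rewrite EV; congr jn; apply: eq_bigr => x _.
    by rewrite block_mxEul.
  by rewrite block_mxEdl mxE.
(* T and L preserve the second block, which accounts for the zero upper right block of P. *)
have [V EV] := trans2 z c; exists (jn 0 V).
rewrite jn_mono2 T_jn2 L_jn2 -jnB subr0 EV; congr jn.
  by rewrite big1 // => x _; rewrite block_mxEur mxE teval0 /mono_mx tmon0 scale0r.
by apply: eq_bigr => x _; rewrite block_mxEdr.
Qed.

End Glue.

(** * Block triangular matrices in either argument of Ext *)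

Section BlockTriangular.

Variables (F : finFieldType) (K : fieldType) (iota : {rmorphism {poly F} -> K}).

Local Notation Kt := (tpoly iota).

(** Only the values at t enter, so block matrices can be handled without first making them into
    t-modules. *)
Definition mx_reduction e d (A : 'M[Kt]_d) (B : 'M[Kt]_e) : Prop :=
  reduction (mulmxr A \- mulmx B : 'M_(e, d) -> 'M_(e, d)) (mulmx B).

Lemma unifm_inner e d (A : 'M[Kt]_d) (B : 'M[Kt]_e) (V : K -> 'M[Kt]_(e, d)) :
  unifm V -> unifm (fun c => (mulmxr A \- mulmx B) (V c)).
Proof.
move=> uV; apply: (@eq_unifm _ _ _ _ _ (fun c => V c *m A - B *m V c)) => //.
by apply: unifmB; [apply: unifm_mulr | apply: unifm_mull].
Qed.

Lemma mx_reduction_dim0 e d (A : 'M[Kt]_d) (B : 'M[Kt]_e) :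
  (e == 0%N) || (d == 0%N) -> mx_reduction A B.
Proof.
move=> ed0; have noij (ij : 'I_e * 'I_d) : False.
  by case: ij => -[i lti] [j ltj]; case/orP: ed0 => /eqP E; subst.
have mx0 (V : 'M[Kt]_(e, d)) : V = 0 by apply/matrixP => i j; case: (noij (i, j)).
exists (fun=> 0), (fun=> 0%N); split.
  split=> [V|ij|ij|V _|W _]; rewrite ?mx0; try by case: (noij ij).
  - exists 0; split=> [|c _]; first by rewrite [RHS]mx0.
    by apply/matrixP => i j; case: (noij (i, j)).
  - by [].
  by exists (fun=> 0) => [|c ij]; [apply: unifm0 | case: (noij ij)].
have g : 'I_0 -> 'I_e * 'I_d * nat by case.
exists 0%N, 0, g; split=> [[] //|ij||[] //]; first by case: (noij ij).
by exists 0%N; rewrite expr0 flatmx0 [RHS]flatmx0.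
Qed.

Lemma mx_reduction_block_source e d1 d2 (A1 : 'M[Kt]_d1) (A2 : 'M[Kt]_d2)
    D (B : 'M[Kt]_e) :
  mx_reduction A1 B -> mx_reduction A2 B -> mx_reduction (block_mx A1 0 D A2) B.
Proof.
(* The last columns of L V depend only on the last columns of V, so they form
   the block that is reduced first. *)
move=> red1 red2.
pose split_idx (ij : 'I_e * 'I_(d1 + d2)) : 'I_e * 'I_d2 + 'I_e * 'I_d1 :=
  match split ij.2 with inl j => inr (ij.1, j) | inr j => inl (ij.1, j) end.
pose h1 (ij : 'I_e * 'I_d2) : 'I_e * 'I_(d1 + d2) := (ij.1, rshift d1 ij.2).
pose h2 (ij : 'I_e * 'I_d1) : 'I_e * 'I_(d1 + d2) := (ij.1, lshift d2 ij.2).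
have jnE (R : Type) (V2 : 'M[R]_(e, d2)) V1 : jn split_idx V2 V1 = row_mx V1 V2.
  by apply/matrixP => i j; rewrite !mxE /split_idx /=; case: split.
have resE (V : 'M[Kt]_(e, d1 + d2)) : res1 h1 V = rsubmx V.
  by apply/matrixP => i j; rewrite !mxE.
apply: (@reduction_glue _ _ _ _ _ _ _ _ _ split_idx h1 h2) red2 red1.
- by move=> [i j]; rewrite /split_idx /= (unsplitK (inr j)).
- by move=> [i j]; rewrite /split_idx /= (unsplitK (inl j)).
- move=> [i j]; rewrite /split_idx /= -[in RHS](splitK j).
  by case: (split j).
- by move=> V; apply: unifm_inner.
- by move=> V uV; apply: unifm_mull.
- move=> V; rewrite !resE /= -{1 2}(hsubmxK V) mul_row_block mul_mx_row.
  by rewrite opp_row_mx add_row_mx row_mxKr mulmx0 add0r.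
- by move=> V; rewrite !resE /= -{1}(hsubmxK V) mul_mx_row row_mxKr.
- move=> V; rewrite !jnE /= mul_row_block mul_mx_row opp_row_mx add_row_mx.
  by rewrite !mul0mx !mulmx0 addr0 add0r subrr.
by move=> V; rewrite !jnE /= mul_mx_row mulmx0.
Qed.

(** B multiplies from the left, so the first rows of L V depend only on the first rows of V: here
    the first block is the one reduced first. *)
Lemma mx_reduction_block_target e1 e2 d (A : 'M[Kt]_d) (B1 : 'M[Kt]_e1)
    (B2 : 'M[Kt]_e2) D :
  mx_reduction A B1 -> mx_reduction A B2 -> mx_reduction A (block_mx B1 0 D B2).
Proof.
pose split_idx (ij : 'I_(e1 + e2) * 'I_d) : 'I_e1 * 'I_d + 'I_e2 * 'I_d :=
  match split ij.1 with inl i => inl (i, ij.2) | inr i => inr (i, ij.2) end.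
pose h1 (ij : 'I_e1 * 'I_d) : 'I_(e1 + e2) * 'I_d := (lshift e2 ij.1, ij.2).
pose h2 (ij : 'I_e2 * 'I_d) : 'I_(e1 + e2) * 'I_d := (rshift e1 ij.1, ij.2).
have jnE (R : Type) (V1 : 'M[R]_(e1, d)) V2 : jn split_idx V1 V2 = col_mx V1 V2.
  by apply/matrixP => i j; rewrite !mxE /split_idx /=; case: split.
have resE (V : 'M[Kt]_(e1 + e2, d)) : res1 h1 V = usubmx V.
  by apply/matrixP => i j; rewrite !mxE.
apply: (@reduction_glue _ _ _ _ _ _ _ _ _ split_idx h1 h2).
- by move=> [i j]; rewrite /split_idx /= (unsplitK (inl i)).
- by move=> [i j]; rewrite /split_idx /= (unsplitK (inr i)).
- move=> [i j]; rewrite /split_idx /= -[in RHS](splitK i).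
  by case: (split i).
- by move=> V; apply: unifm_inner.
- by move=> V uV; apply: unifm_mull.
- move=> V; rewrite !resE /= -{1 2}(vsubmxK V) mul_block_col mul_col_mx.
  by rewrite opp_col_mx add_col_mx col_mxKu mul0mx addr0.
- by move=> V; rewrite !resE /= -{1}(vsubmxK V) mul_block_col col_mxKu mul0mx addr0.
- move=> V; rewrite !jnE /= mul_block_col mul_col_mx opp_col_mx add_col_mx.
  by rewrite !mul0mx !mulmx0 !addr0 !add0r oppr0.
by move=> V; rewrite !jnE /= mul_block_col mul0mx !mulmx0 addr0 add0r.
Qed.

End BlockTriangular.

(** * From t-modules to matrices: Baer equivalence and the consequences of Hom = 0 *)

Section TReductionMatrix.

Variables (F : finFieldType) (K : fieldType) (iota : {rmorphism {poly F} -> K}).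

Local Notation Kt := (tpoly iota).
Local Notation tconst := (tconst iota).
Local Notation scal := (scal_mx iota).

(** Moving the constant past tau^k raises it to the power q^k, and a^q = a for a in F. *)
Lemma tconst_central (a : F) (f : Kt) : tconst (iota a%:P) * f = f * tconst (iota a%:P).
Proof.
apply: tpolyP => k; rewrite tcoef_mon_mul tcoef_mul_rev subn0 expn0 expr1.
rewrite (bigD1 ord0) //= subn0 tcoef_tmon -rmorphXn -polyC_exp.
rewrite big1 => [|i /negPf nz_i]; last first.
  by rewrite tcoef_tmon -[val i == 0%N]/(i == ord0) nz_i expr0q mulr0.
rewrite addr0 mulrC; congr (_ * iota _%:P).
by elim: k => [|k IHk]; rewrite ?expr1 // expnSr exprM -IHk expf_card.
Qed.

(** In positive size this is evaluation at P, which commutes with the constants by [tconst_central];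
    in size 0 the zero map is a ring morphism. *)
Lemma exists_act n (P : 'M[Kt]_n) : exists act : {rmorphism {poly F} -> 'M[Kt]_n},
  act 'X = P /\ forall a : F, act a%:P = (tconst (iota a%:P))%:M.
Proof.
case: n P => [|n] P.
  pose act (_ : {poly F}) : 'M[Kt]_0 := 0.
  have act_add : zmod_morphism act by move=> a b; rewrite flatmx0 [RHS]flatmx0.
  have act_mul : monoid_morphism act by split=> [|a b]; rewrite flatmx0 [RHS]flatmx0.
  pose actM := GRing.isMonoidMorphism.Build _ _ act act_mul.
  pose actA := GRing.isZmodMorphism.Build _ _ act act_add.
  pose actR : {rmorphism {poly F} -> 'M[Kt]_0} := HB.pack act actM actA.
  by exists actR; split=> [|a]; rewrite flatmx0 [RHS]flatmx0.
pose f : {rmorphism F -> 'M[Kt]_n.+1} := (@scalar_mx Kt n.+1) \o tconst \o iota \o polyC.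
have cfP : commr_rmorph f P.
  move=> a; apply/matrixP => i j; rewrite /= -!mulmxE mul_scalar_mx.
  by rewrite -diag_const_mx mul_mx_diag !mxE tconst_central.
exists (horner_morph cfP); split=> [|a]; first exact: horner_morphX.
exact: horner_morphC.
Qed.

(** It delivers the fields of a t-module instead of the t-module itself, so that the dimension is n
    by conversion and no casts arise. *)
Lemma exists_tmodule_act n (P : 'M[Kt]_n) :
  (exists k, (map_mx (@tangent _ _ iota) P - (iota 'X)%:M) ^+ k = 0) ->
  exists act : {rmorphism {poly F} -> 'M[Kt]_n},
  [/\ act 'X = P, forall a : F, act a%:P = (tconst (iota a%:P))%:M &
      exists2 N : 'M[K]_n, exists k, N ^+ k = 0 &
        map_mx (fun f => tcoef f 0) (act 'X) = (iota 'X)%:M + N].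
Proof.
move=> nilpP; have [act [actX actC]] := exists_act P; exists act; split=> //.
by rewrite actX; eexists; [exact: nilpP | rewrite addrC subrK].
Qed.

Variables Phi Psi : tmodule iota.

Local Notation d := (tdim Phi).
Local Notation e := (tdim Psi).
Local Notation L := (mulmxr (Phi 'X) \- mulmx (Psi 'X) : 'M[Kt]_(e, d) -> 'M[Kt]_(e, d)).

(** Compatibility with the inclusion and the projection forces h to be unipotent with a single free
    block V in the lower left corner; the intertwining relation then reads V Phi_t + W1 = W2 + Psi_t
    V. *)
Lemma same_extP (W1 W2 : 'M[Kt]_(e, d)) :
  same_ext W1 W2 <-> exists V, W2 - W1 = L V.
Proof.
split=> [[h [E h0 h1]] | [V E]]; last first.
  exists (block_mx 1%:M 0 V 1%:M); split.
  - rewrite !mulmx_block ?(mul1mx, mul0mx, mulmx0, mulmx1, addr0, add0r).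
    by move/(canRL (subrK _)): E => /= ->; rewrite [in RHS]addrAC subrK.
  - by rewrite mul_block_col !mulmx0 !mulmx1 !add0r.
  by rewrite mul_row_block !mul1mx !mul0mx !addr0.
rewrite -(submxK h) in E h0 h1.
move: h0 h1 E; rewrite mul_block_col mul_row_block.
rewrite !mulmx0 !mulmx1 !mul1mx !mul0mx !addr0 !add0r.
move=> /eq_col_mx[-> ->] /eq_row_mx[-> _].
rewrite !mulmx_block ?(mul1mx, mul0mx, mulmx0, mulmx1, addr0, add0r).
move=> /eq_block_mx[_ _ E _]; exists (dlsubmx h).
by move/(canRL (addrK _)): E => /= ->; rewrite [RHS]addrAC addrK.
Qed.

Lemma inner_comb (U : 'I_e * 'I_d -> 'M[K]_(e, d)) c a :
  inner (comb iota U c) a = \sum_ij \sum_(k < size (c ij.1 ij.2))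
    inner (gen U (c ij.1 ij.2)`_k k ij) a.
Proof.
rewrite [LHS](raddf_sum (mulmxr (Phi a) \- mulmx (Psi a))).
apply: eq_bigr => ij _.
by rewrite (raddf_sum (mulmxr (Phi a) \- mulmx (Psi a))).
Qed.

(** The kernel of L is Hom, so L is injective and condition A becomes [scal_basis]. Uniform
    reduction of monomials extends to all uniform families by [unifm_ind]. *)
Lemma t_reduction_mx : (forall f : 'M[Kt]_(e, d), is_hom f -> f = 0) ->
  t_reduction Phi Psi -> mx_reduction (Phi 'X) (Psi 'X).
Proof.
move=> hom0 [U [N [_ [[cA cB degN _ cD] [unifU [Pi [f [[f' fK f'K] trans]]]]]]]].
have injL (V : 'M[Kt]_(e, d)) : L V = 0 -> V = 0.
  by move=> /eqP; rewrite subr_eq0 => /eqP; apply: hom0.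
exists U, N; split.
  split.
  - move=> V; have [c [cV uniq_c]] := cA V; exists c; split.
      apply/eqP; rewrite -subr_eq0; apply/eqP/injL.
      rewrite raddfB; apply/eqP; rewrite subr_eq0; apply/eqP.
      exact: etrans (cV 'X) (esym (inner_comb U c 'X)).
    by move=> c' V_c'; apply: uniq_c => a; rewrite V_c' inner_comb.
  - exact: cB.
  - exact: degN.
  (* L V is inner, so it represents the same class as 0, and condition D gives L V = 0. *)
  - move=> V dV; apply/injL/esym/(cD 0 (L V)) => //; first exact: degm0.
    by apply/same_extP; exists V; rewrite subr0.
  apply: unifm_ind => [W1 W2 eqW [V uV dV]||W1 W2 [V1 uV1 dV1] [V2 uV2 dV2]|g k ij].
  - by exists V => // c; rewrite -eqW.
  - by exists (fun=> 0) => [|c]; [apply: unifm0 | rewrite raddf0 subrr; apply: degm0].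
  - exists (fun c => V1 c + V2 c) => [|c]; first exact: unifmD.
    by rewrite (raddfD L) opprD addrACA; apply: degmD.
  have [s sP] := unifU ij k.
  (* The reduction of the monomial is used at the parameter g(c); substitution is multiplication by
     g on the right. *)
  exists (fun c => \sum_(x <- s) scal (teval (x.1.1 * g) c) x.1.2 (U x.2)).
    by apply: unifm_sum => x; apply: unifm_scal.
  move=> c; have := sP (teval g c).
  rewrite (raddf_sum L); under [in X in _ -> X]eq_bigr do rewrite tevalM.
  by [].
exists (tdim Pi), (Pi 'X), (fun y => (tag (f y), val (tagged (f y)))); split.
- move=> x y [] Etag Eval; apply: (can_inj fK).
  case: (f x) (f y) Etag Eval => [ij k] [ij' k'] /= E.
  by subst ij' => E; congr existT; apply: val_inj.
- move=> ij k; apply/codomP/idP => [[y] [-> ->]|lt_kN]; first exact: ltn_ord.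
  by exists (f' (existT _ ij (Ordinal lt_kN))); rewrite f'K.
- have [N0 [k N0k] ->] := tact_tangent Pi.
  by exists k; rewrite addrAC subrr add0r.
move=> y c; have [s Es] := trans y c; exists (\sum_(x <- s) scal x.1.1 x.1.2 (U x.2)).
by rewrite (raddf_sum L) [RHS]Es.
Qed.

End TReductionMatrix.

(** * Back from matrices to t-reductions of t-modules *)

Section MatrixTReduction.

Variables (F : finFieldType) (K : fieldType) (iota : {rmorphism {poly F} -> K}).

Local Notation Kt := (tpoly iota).
Local Notation tconst := (tconst iota).
Local Notation tmon := (tmon iota).
Local Notation tsize := Defs.tsize.
Local Notation emon := (mono_mx iota).

(* Makes condition C a consequence of uniform reduction. *)
Lemma unifm_at1 e d (W : 'M[Kt]_(e, d)) : exists2 W', unifm W' & W' 1 = W.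
Proof.
exists (fun c => \matrix_(i, j) \sum_(k < tsize (W i j)) tmon (tcoef (W i j) k * c) k).
  move=> i j; apply: (@eq_unif _ _ _ (fun c => \sum_(k < tsize (W i j))
    tmon (teval (tconst (tcoef (W i j) k)) c) k)) => [c|].
    by rewrite mxE; apply: eq_bigr => k _; rewrite teval_tmon expn0 expr1.
  by apply: unif_sum => k; apply: unif_tmon.
apply/matrixP => i j; rewrite mxE [RHS](tpoly_sum (leqnn _)).
by apply: eq_bigr => k _; rewrite mulr1.
Qed.

(** Expanding a constant matrix in the twisted basis and keeping the constant terms shows that the
    U_ij span over K; there are e d of them, the dimension of the space. *)
Lemma scal_basis_span e d (U : 'I_e * 'I_d -> 'M[K]_(e, d)) :
  scal_basis iota U -> basis_of fullv (codom U).
Proof.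
move=> basU; rewrite basisEdim size_codom dimvf /dim /= card_prod !card_ord.
rewrite leqnn andbT; apply/subvP => A _.
have [p [/(congr1 (map_mx (@tangent _ _ iota))) EA _]] := basU (map_mx tconst A).
suff -> : A = \sum_ij \sum_(k < size (p ij.1 ij.2))
    (if k == 0%N :> nat then (p ij.1 ij.2)`_k else 0) *: U ij.
  apply: memv_suml => ij _; apply: memv_suml => k _.
  by rewrite memvZ // memv_span ?codom_f.
transitivity (map_mx (@tangent _ _ iota) (map_mx tconst A)).
  by apply/matrixP => i j; rewrite !mxE tangent_const.
rewrite EA /comb raddf_sum; apply: eq_bigr => ij _.
rewrite raddf_sum; apply: eq_bigr => k _; apply/matrixP => i j; rewrite !mxE.
by rewrite /= rmorphM /= tangent_const /tangent tcoef_tmon eq_sym.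
Qed.

Variables Phi Psi : tmodule iota.

Local Notation d := (tdim Phi).
Local Notation e := (tdim Psi).
Local Notation L := (mulmxr (Phi 'X) \- mulmx (Psi 'X) : 'M[Kt]_(e, d) -> 'M[Kt]_(e, d)).

(** The separation property makes L injective, which yields uniqueness in condition A, and it is
    condition D read through [same_extP]. *)
Lemma mx_t_reduction : mx_reduction (Phi 'X) (Psi 'X) -> t_reduction Phi Psi.
Proof.
move=> [U [N [[bas lead deg sepL unifL] [n [P [g [injg codg nilpP trans]]]]]]].
have injL (V : 'M[Kt]_(e, d)) : L V = 0 -> V = 0.
  by move=> LV0; apply: sepL; rewrite LV0; apply: degm0.
have inner_seq (V : 'M[Kt]_(e, d)) : exists s : seq (K * nat * ('I_e * 'I_d)),
    L V = \sum_(x <- s) inner_gen U x.1.1 x.1.2 x.2.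
  have [V' /(unifm_comb bas)[s sP] <-] := unifm_at1 V.
  exists [seq (teval x.1.1 1, x.1.2, x.2) | x <- s].
  by rewrite sP (raddf_sum L) big_map.
exists U, N; split; first exact: scal_basis_span bas.
split; [split|split].
- move=> V; have [c [cV uniq_c]] := bas V; exists c; split=> [a|c' /(_ 'X) Ec'].
    by rewrite {1}cV inner_comb.
  apply: uniq_c; apply/eqP; rewrite -subr_eq0; apply/eqP/injL.
  rewrite (raddfB L); apply/eqP; rewrite subr_eq0; apply/eqP.
  exact: etrans Ec' (esym (inner_comb U c' 'X)).
- exact: lead.
- exact: deg.
- move=> delta _; have [W uW W1] := unifm_at1 (delta 'X).
  have [V _ dV] := unifL W uW; exists (delta 'X - L (V 1)).
    by have [s ->] := inner_seq (V 1); exists s.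
  by rewrite -W1; apply: dV.
- move=> W1 W2 dW1 dW2 /same_extP[V EV].
  have V0 : V = 0 by apply: sepL; rewrite -EV; apply: degmB.
  by apply/esym/eqP; rewrite -subr_eq0 EV V0 raddf0.
- move=> ij k; have uW : unifm (fun c => emon c k ij).
    by apply: eq_unifm (unifm_mono 1 _ _) => c; rewrite teval1.
  have [V /(unifm_comb bas)[s sP] dV] := unifL _ uW.
  by exists s => c; have := dV c; rewrite sP (raddf_sum L).
have [act [PiX C T]] := exists_tmodule_act nilpP.
have ltN y : ((g y).2 < N (g y).1)%N by rewrite -codg -surjective_pairing codom_f.
pose f (y : 'I_n) : Defs.coord N := existT _ (g y).1 (Ordinal (ltN y)).
have injf : injective f.
  move=> x y /(congr1 (fun z : Defs.coord N => (tag z, val (tagged z)))) /= E.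
  by apply: injg; rewrite [LHS]surjective_pairing E -surjective_pairing.
(* By [codg] every pair ((i, j), k) with k < N_ij is a value of g, so the injective f is onto. *)
have bijf : bijective f.
  apply: (inj_card_bij injf); rewrite -(card_codom injf); apply/subset_leq_card.
  apply/subsetP => -[ij [k lt_kN]] _; have := lt_kN; rewrite -codg => /codomP[y Ey].
  apply/codomP; exists y; rewrite /f; move: (ltN y); rewrite -Ey /= => lt'.
  by congr existT; apply: val_inj.
exists (TModule C T), f; split=> // y c.
have [V EV] := trans y c; have [s Es] := inner_seq V; exists s.
by rewrite -Es PiX; apply/esym.
Qed.

End MatrixTReduction.

(** * Induction along the filtrations *)

Section Devissage.

Variables (F : finFieldType) (K : fieldType) (iota : {rmorphism {poly F} -> K}).

Local Notation Kt := (tpoly iota).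

(* A behaves, in both arguments of Ext, like an iterated extension of the Q j, j < i. *)
Definition devissage (Q : nat -> tmodule iota) i n (A : 'M[Kt]_n) : Prop :=
  (forall e (B : 'M[Kt]_e), (forall j, (j < i)%N -> mx_reduction (Q j 'X) B) ->
     mx_reduction A B) /\
  (forall d (B : 'M[Kt]_d), (forall j, (j < i)%N -> mx_reduction B (Q j 'X)) ->
     mx_reduction B A).

Lemma devissage0 Q n (A : 'M[Kt]_n) : n = 0%N -> devissage Q 0 A.
Proof. by move=> n0; split=> m B _; apply: mx_reduction_dim0; rewrite n0 ?orbT. Qed.

Lemma devissageS Q i n (A : 'M[Kt]_n) D :
  devissage Q i A -> devissage Q i.+1 (block_mx (Q i 'X) 0 D A).
Proof.
move=> [src tgt]; split=> m B QB.
  apply: mx_reduction_block_source; first exact: QB.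
  by apply: src => j /ltnW/QB.
apply: mx_reduction_block_target; first exact: QB.
by apply: tgt => j /ltnW/QB.
Qed.

Lemma series_devissage n Gamma (S : series n Gamma) : in_block_form S ->
  devissage (squo S) n (Gamma 'X).
Proof.
move=> blockS; suff devS i : (i <= n)%N -> devissage (squo S) i (smod S i 'X).
  by have := devS n (leqnn n); rewrite (stop S).
elim: i => [|i IHi] le_in; first exact/devissage0/sbot.
have [delta [E [_ /(_ 'X) EX _ _]]] := blockS i le_in.
have := devissageS (delta 'X) (IHi (ltnW le_in)); rewrite -EX {EX}.
(* With the dimension generalized to a variable, E can be substituted and the cast disappears. *)
by move: (smod S i.+1 'X) E; move: (tdim _) => k A E; subst k; rewrite castmx_id.
Qed.

(** Every step of the filtration is block triangular up to isomorphism, and these changes of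
    coordinates are accumulated in g. Plain matrices suffice here; the t-module structure is
    restored only at the end. *)
Lemma series_devissage_iso n Gamma (S : series n Gamma) :
  exists m (A : 'M[Kt]_m) (g : 'M_(m, tdim Gamma)) h,
  [/\ g *m h = 1%:M, h *m g = 1%:M, g *m Gamma 'X = A *m g & devissage (squo S) n A].
Proof.
suff devS i : (i <= n)%N -> exists m (A : 'M[Kt]_m) (g : 'M_(m, tdim (smod S i))) h,
    [/\ g *m h = 1%:M, h *m g = 1%:M, g *m smod S i 'X = A *m g & devissage (squo S) i A].
  by have := devS n (leqnn n); rewrite (stop S).
elim: i => [|i IHi] le_in.
  exists (tdim (smod S 0)), (smod S 0 'X), 1%:M, 1%:M.
  by rewrite !mulmx1 mul1mx; split=> //; apply/devissage0/sbot.
have [m [A [g [h [gh hg gA devA]]]]] := IHi (ltnW le_in).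
have [Gam [_ [_ [G [[delta [E [_ /(_ 'X) EX _ _]]] isoG _ _]]]]] := sexact S le_in.
case: isoG => GX [G' [GG' G'G]].
(* This is the block form of the step conjugated by diag(1, g), which replaces M_i by A and delta_t
   by g delta_t. *)
exists (tdim (squo S i) + m)%N, (block_mx (squo S i 'X) 0 (g *m delta 'X) A).
have devA' := devissageS (g *m delta 'X) devA.
rewrite /is_hom in GX.
move: (Gam 'X) G G' E EX GX GG' G'G; move: (tdim Gam) => k B G G' E.
subst k; rewrite castmx_id => -> GX GG' G'G.
exists (block_mx 1%:M 0 0 g *m G), (G' *m block_mx 1%:M 0 0 h); split=> //.
- rewrite mulmxA -(mulmxA _ G) GG' mulmx1 mulmx_block.
  by rewrite ?(mul1mx, mul0mx, mulmx0, mulmx1, addr0, add0r) gh -scalar_mx_block.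
- rewrite mulmxA -(mulmxA G') mulmx_block.
  by rewrite ?(mul1mx, mul0mx, mulmx0, mulmx1, addr0, add0r) hg -scalar_mx_block mulmx1.
rewrite -mulmxA GX !mulmxA !mulmx_block.
by rewrite ?(mul1mx, mul0mx, mulmx0, mulmx1, addr0, add0r) gA.
Qed.

(** Modulo tau, conjugation fixes the scalar matrix theta and sends N to g N h, whose k-th power is
    g N^k h; so the constant term keeps its required form. *)
Lemma exists_conjugate_tmodule (Gamma : tmodule iota) m (A : 'M[Kt]_m)
    (g : 'M_(m, tdim Gamma)) h :
  g *m h = 1%:M -> h *m g = 1%:M -> g *m Gamma 'X = A *m g ->
  exists act : {rmorphism {poly F} -> 'M[Kt]_m}, exists C T,
  act 'X = A /\ isomorphic Gamma (@TModule F K iota m act C T).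
Proof.
move=> gh hg gA; pose tan := @tangent F K iota.
have [N [k Nk] EN] := tact_tangent Gamma.
have EA : A = g *m Gamma 'X *m h by rewrite gA -mulmxA gh mulmx1.
have gh0 : map_mx tan g *m map_mx tan h = 1%:M by rewrite -map_mxM gh map_mx1.
have hg0 : map_mx tan h *m map_mx tan g = 1%:M by rewrite -map_mxM hg map_mx1.
have nilpA : exists k, (map_mx tan A - (iota 'X)%:M) ^+ k = 0.
  exists k; have -> : map_mx tan A - (iota 'X)%:M = map_mx tan g *m N *m map_mx tan h.
    rewrite EA !map_mxM [map_mx _ (Gamma 'X)]EN mulmxDr mulmxDl mul_mx_scalar.
    by rewrite -scalemxAl gh0 scalemx1 addrC addKr.
  have -> : (map_mx tan g *m N *m map_mx tan h) ^+ k =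
      map_mx tan g *m N ^+ k *m map_mx tan h.
    elim: {Nk} k => [|k IHk]; first by rewrite !expr0 mulmx1 gh0.
    by rewrite !exprS IHk -!mulmxE !mulmxA -(mulmxA _ (map_mx tan h)) hg0 mulmx1.
  by rewrite Nk mulmx0 mul0mx.
have [act [actX C T]] := exists_tmodule_act nilpA.
exists act, C, T; split=> //; exists g; split; first by rewrite /is_hom /= actX.
by exists h.
Qed.

End Devissage.

(** Arbitrary filtrations become block triangular only after conjugation, whence a conclusion up to
    isomorphism; for filtrations already in block form the given coordinates serve. *)
Theorem theorem5p2 (F : finFieldType) (K : fieldType)
  (iota : {rmorphism {poly F} -> K})
  (Ups Ups' : tmodule iota) (n m : nat)
  (filt : series n Ups) (filt' : series m Ups')
  (simple_filt : forall i, (i < n)%N -> tau_simple (squo filt i))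
  (simple_filt' : forall j, (j < m)%N -> tau_simple (squo filt' j))
  (hom0 : forall i j, (i < n)%N -> (j < m)%N ->
    forall f : 'M[tpoly iota]_(tdim (squo filt' j), tdim (squo filt i)),
    is_hom f -> f = 0)
  (ext_filt : forall i j, (i < n)%N -> (j < m)%N ->
    t_reduction (squo filt i) (squo filt' j)) :
  t_reduction_upto_iso Ups Ups' /\
  (in_block_form filt -> in_block_form filt' -> t_reduction Ups Ups').
Proof.
have redQ i j : (i < n)%N -> (j < m)%N ->
    mx_reduction (squo filt i 'X) (squo filt' j 'X).
  by move=> lt_in lt_jm; apply: t_reduction_mx; [apply: hom0 | apply: ext_filt].
have red d e (A : 'M_d) (B : 'M_e) :
    devissage (squo filt) n A -> devissage (squo filt') m B -> mx_reduction A B.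
  (* Devissage of the first argument with B fixed, then of the second for each simple quotient of
     the first. *)
  move=> [srcA _] [_ tgtB]; apply: srcA => i lt_in; apply: tgtB => j lt_jm.
  exact: redQ.
split=> [|blk blk']; last first.
  by apply: mx_t_reduction; apply: red; apply: series_devissage.
have [d [A [g [h [gh hg gA devA]]]]] := series_devissage_iso filt.
have [e [B [g' [h' [gh' hg' gB devB]]]]] := series_devissage_iso filt'.
have [actA [CA [TA [EA isoA]]]] := exists_conjugate_tmodule gh hg gA.
have [actB [CB [TB [EB isoB]]]] := exists_conjugate_tmodule gh' hg' gB.
exists (TModule CA TA), (TModule CB TB); split=> //.
by apply: mx_t_reduction; rewrite /= EA EB; apply: red.
Qed.
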